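(* Let $k>3$ be a fixed integer. The problems $\textsc{EnumClosureMax}_{S_{10}^k}$ and $\textsc{EnumKMaxIndSet}$ (for hypergraphs of dimension $k$) are equivalent under polynomial delay reductions.
   Context: Boolean vectors in $\{0,1\}^n$ are ordered by inclusion of their sets of $1$-coordinates. Operations act coordinate-wise on vectors; $Cl_{\mathcal{F}}(\mathcal{S})$ is the smallest set containing $\mathcal{S}$ closed under the operations of $\mathcal{F}$. $Th_k^{k+1}:\{0,1\}^{k+1}\to\{0,1\}$ returns $1$ iff at least $k$ of its arguments are $1$. $S_{10}^k$ is the clone generated by $Th_k^{k+1}$. $\textsc{EnumClosureMax}_{\mathcal{F}}$: given finite $\mathcal{S}\subseteq\{0,1\}^n$, enumerate without repetition the maximal elements of $Cl_{\mathcal{F}}(\mathcal{S})\setminus\{\mathbf{0},\mathbf{1}\}$. A hypergraph has dimension $k$ if its largest hyperedge has size $k$; an independent set is a vertex subset containing no hyperedge; $\textsc{EnumKMaxIndSet}$: given a hypergraph of dimension $k$, enumerate its inclusion-maximal independent sets. A polynomial delay reduction from $A$ to $B$ consists of a polynomial-time function $f$ and an enumeration problem $C$ solvable with polynomial delay such that for every instance $x$ of $A$: for distinct $y,z\in B(f(x))$, $C(xy)\cap C(xz)=\emptyset$, and $A(x)=\bigcup_{y\in B(f(x))}C(xy)$. Equivalent means each reduces to the other. *)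

(* Defs.v *)
From mathcomp Require Import all_boot.

Set Implicit Arguments.
Unset Strict Implicit.
Unset Printing Implicit Defensive.

Notation word := (seq bool).

(** * Random access machines with logarithmic cost

    Machines in the style of Cook and Reckhow, with registers [R] kept apart
    from the indirectly addressed memory [M].  All register names and jump
    targets are constants of the program; a machine halts when its program
    counter leaves the program. *)

Inductive instr : Type :=
| IConst of nat & nat          (* R[r] := n                                  *)
| IAdd of nat & nat & nat      (* R[r] := R[s] + R[t]                        *)
| ISub of nat & nat & nat      (* R[r] := R[s] - R[t], truncated at 0        *)
| ILoad of nat & nat           (* R[r] := M[R[s]]                            *)
| IStore of nat & nat          (* M[R[r]] := R[s]                            *)
| IJz of nat & nat             (* jump to l if R[r] = 0                      *)
| IWrite of nat                (* append the bit R[r] != 0 to the word being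
                                 written                                    *)
| IEmit.                       (* output the word written so far and start a
                                 new, empty one                             *)

Definition program := seq instr.

(** [outs] lists the words output so far, in order, each with the value of the
    clock when its output was completed. *)
Record config : Type := Config {
  pc : nat;
  reg : nat -> nat;
  mem : nat -> nat;
  buf : word;
  outs : seq (nat * word);
  clock : nat
}.

Definition bitlen (n : nat) : nat := (trunc_log 2 n).+1.

Definition cost (i : instr) (R M : nat -> nat) : nat :=
  match i with
  | IConst _ n => bitlen n
  | IAdd _ s t | ISub _ s t => bitlen (R s) + bitlen (R t)
  | ILoad _ s => bitlen (R s) + bitlen (M (R s))
  | IStore r s => bitlen (R r) + bitlen (R s)
  | IJz r _ | IWrite r => bitlen (R r)
  | IEmit => 1
  end.

Definition exec (i : instr) (c : config) : config :=
  let: Config p R M b o t := c in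
  let t' := t + cost i R M in
  match i with
  | IConst r n => Config p.+1 [eta R with r |-> n] M b o t'
  | IAdd r s u => Config p.+1 [eta R with r |-> R s + R u] M b o t'
  | ISub r s u => Config p.+1 [eta R with r |-> R s - R u] M b o t'
  | ILoad r s => Config p.+1 [eta R with r |-> M (R s)] M b o t'
  | IStore r s => Config p.+1 R [eta M with R r |-> R s] b o t'
  | IJz r l => Config (if R r == 0 then l else p.+1) R M b o t'
  | IWrite r => Config p.+1 R M (rcons b (R r != 0)) o t'
  | IEmit => Config p.+1 R M [::] (rcons o (t', b)) t'
  end.

Definition step (P : program) (c : config) : config :=
  if onth P (pc c) is Some i then exec i c else c.

Definition halted (P : program) (c : config) : bool := size P <= pc c.

(** The input word occupies [M[0], ..., M[size w - 1]] and its length is in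
    [R[0]]; everything else is 0. *)
Definition init (w : word) : config :=
  Config 0 [eta (fun=> 0) with 0 |-> size w] (fun a => nth false w a : nat)
    [::] [::] 0.

Definition run (P : program) (w : word) (t : nat) : config :=
  iter t (step P) (init w).

(** * Enumeration problems and polynomial delay reductions *)

Record enum_problem : Type := EnumProblem {
  inst : Type;
  enc : inst -> word;
  enc_inj : injective enc;
  solution : inst -> word -> Prop
}.

Definition polybound (c n : nat) : nat := c * n ^ c + c.

Definition polytime (A B : enum_problem) (f : inst A -> inst B) : Prop :=
  exists (P : program) (c : nat), forall x : inst A, exists t : nat,
    let final := run P (enc x) t in
    [/\ halted P final,
        unzip2 (outs final) = [:: enc (f x)]
      & clock final <= polybound c (size (enc x))].

(** The bound applies to the time before the first output, to the time between
    two consecutive outputs and to the time between the last output and the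
    halting of the machine. *)
Definition polydelay (A : enum_problem) : Prop :=
  exists (P : program) (c : nat), forall x : inst A, exists t : nat,
    let final := run P (enc x) t in
    let D := polybound c (size (enc x)) in
    [/\ halted P final,
        uniq (unzip2 (outs final)),
        forall y : word, y \in unzip2 (outs final) <-> solution x y
      & path (fun s s' => s' <= s + D) 0
          (rcons (unzip1 (outs final)) (clock final))].

Lemma nseq_header_inj (n m : nat) (u v : word) :
  nseq n true ++ false :: u = nseq m true ++ false :: v -> n = m /\ u = v.
Proof. by elim: n m => [|n IH] [|m] //= => [[]|[/IH [-> ->]]]. Qed.

Definition enc_pair (A : enum_problem) (xy : inst A * word) : word :=
  nseq (size (enc xy.1)) true ++ false :: enc xy.1 ++ xy.2.

Lemma enc_pair_inj (A : enum_problem) : injective (@enc_pair A).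
Proof.
case=> x y [x' y'] /nseq_header_inj /= [Es] /eqP.
by rewrite eqseq_cat // => /andP[/eqP/enc_inj -> /eqP ->].
Qed.

Definition pair_problem (A : enum_problem) (C : inst A * word -> word -> Prop) :
    enum_problem :=
  EnumProblem (@enc_pair_inj A) C.

Definition polydelay_reduction (A B : enum_problem) : Prop :=
  exists (f : inst A -> inst B) (C : inst A * word -> word -> Prop),
    [/\ polytime f,
        polydelay (pair_problem C),
        forall (x : inst A) (y z : word),
          solution (f x) y -> solution (f x) z -> y <> z ->
          forall s : word, ~ (C (x, y) s /\ C (x, z) s)
      & forall (x : inst A) (s : word),
          solution x s <-> exists2 y, solution (f x) y & C (x, y) s].

Definition polydelay_equivalent (A B : enum_problem) : Prop :=
  polydelay_reduction A B /\ polydelay_reduction B A.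

(** * Encoding of lists of Boolean vectors

    The dimension in unary, then the vectors, each preceded by [true], then
    [false]. *)

Definition bvlist : Type := {n : nat & seq (n.-tuple bool)}.

Definition enc_bvlist (S : bvlist) : word :=
  nseq (tag S) true ++
  false :: flatten [seq true :: tval v | v <- tagged S] ++ [:: false].

Lemma enc_bvlist_inj : injective enc_bvlist.
Proof.
case=> n s [m s']; rewrite /enc_bvlist /= => /nseq_header_inj [nm]; subst m => E.
congr existT; elim: s s' E => [|a s IH] [|b s'] //=; first last.
  case=> /eqP; rewrite -!catA eqseq_cat ?size_tuple // => /andP[/eqP/val_inj->].
  by move=> /eqP /IH ->.
Qed.

(** * Closure of sets of Boolean vectors *)

Definition bop (m : nat) : Type := {ffun m.-tuple bool -> bool}.

Inductive clone (a : nat) (g0 : bop a) : forall m : nat, bop m -> Prop :=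
| clone_gen : clone g0 g0
| clone_proj (m : nat) (i : 'I_m) :
    clone g0 [ffun x : m.-tuple bool => tnth x i]
| clone_comp (m l : nat) (g : bop m) (h : 'I_m -> bop l) :
    clone g0 g -> (forall i, clone g0 (h i)) ->
    clone g0 [ffun x : l.-tuple bool => g [tuple h i x | i < m]].

Inductive Cl (F : forall m : nat, bop m -> Prop) (n : nat)
    (S : seq (n.-tuple bool)) : n.-tuple bool -> Prop :=
| Cl_base (v : n.-tuple bool) : v \in S -> Cl F S v
| Cl_op (m : nat) (f : bop m) (vs : 'I_m -> n.-tuple bool) :
    F m f -> (forall i, Cl F S (vs i)) ->
    Cl F S [tuple f [tuple tnth (vs i) j | i < m] | j < n].

Definition Th (k l : nat) : bop l := [ffun x : l.-tuple bool => k <= count id x].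

Definition S10 (k : nat) : forall m : nat, bop m -> Prop :=
  clone (Th k k.+1).

Definition bvle (n : nat) (v w : n.-tuple bool) : Prop :=
  forall i, tnth v i -> tnth w i.

Definition ClNontrivial (F : forall m : nat, bop m -> Prop) (n : nat)
    (S : seq (n.-tuple bool)) (v : n.-tuple bool) : Prop :=
  [/\ Cl F S v, v <> [tuple of nseq n false] & v <> [tuple of nseq n true]].

Definition ClMax (F : forall m : nat, bop m -> Prop) (n : nat)
    (S : seq (n.-tuple bool)) (v : n.-tuple bool) : Prop :=
  ClNontrivial F S v /\
  forall w, ClNontrivial F S w -> bvle v w -> w = v.

(** An instance lists the elements of a finite set of vectors, in any order and
    possibly with repetitions. *)
Definition EnumClosureMax (F : forall m : nat, bop m -> Prop) : enum_problem :=
  @EnumProblem bvlist enc_bvlist enc_bvlist_inj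
    (fun S y => exists2 v, ClMax F (tagged S) v & y = tval v).

(** * Maximal independent sets of hypergraphs *)

(** The vertices are ['I_(tag H)] and [tagged H] lists the hyperedges. *)
Definition hypergraph : Type := {n : nat & seq {set 'I_n}}.

Definition dimension (H : hypergraph) : nat := \max_(e <- tagged H) #|e|.

Definition independent (H : hypergraph) (I : {set 'I_(tag H)}) : bool :=
  all (fun e : {set 'I_(tag H)} => ~~ (e \subset I)) (tagged H).

Definition charvec (n : nat) (I : {set 'I_n}) : n.-tuple bool :=
  [tuple i \in I | i < n].

Definition enc_hypergraph (H : hypergraph) : word :=
  enc_bvlist (existT _ (tag H) (map (@charvec (tag H)) (tagged H))).

Lemma charvec_inj (n : nat) : injective (@charvec n).
Proof.
move=> I J E; apply/setP => i.
by move: (congr1 (fun v => tnth v i) E); rewrite !tnth_mktuple.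
Qed.

Lemma enc_hypergraph_inj : injective enc_hypergraph.
Proof.
case=> n s [m s'] /enc_bvlist_inj /= E.
move: (congr1 tag E) => /= nm; subst m; congr existT.
move/eqP: E; rewrite -[X in X == _]/(Tagged (fun n => seq (n.-tuple bool)) _).
by rewrite eq_Tagged => /eqP /(inj_map (@charvec_inj n)).
Qed.

Definition khypergraph (k : nat) : Type := {H : hypergraph | dimension H == k}.

Lemma enc_khypergraph_inj (k : nat) :
  injective (fun H : khypergraph k => enc_hypergraph (val H)).
Proof. by move=> G H /enc_hypergraph_inj /val_inj. Qed.

Definition EnumKMaxIndSet (k : nat) : enum_problem :=
  EnumProblem (@enc_khypergraph_inj k)
    (fun H y => exists2 I : {set 'I_(tag (val H))},
       maxset (@independent (val H)) I & y = tval (charvec I)).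

(* Main.v *)
(** The closure [Cl (S10 k) S] consists of the vectors satisfying all the
    constraints of three kinds that hold in [S]: at most [k] coordinates are
    not all 1 at once, one coordinate implies another one, a coordinate is
    constantly 1; this is the Baker-Pixley theorem for the near-unanimity
    function [Th k k.+1].  A set that is maximal for the constraints of the
    first kind satisfies the two others.  Hence the maximal elements of the
    closure are the maximal independent sets of the hypergraph whose edges are
    the sets of at most [k] coordinates contained in no vector of [S].  The
    exception is the case where there are no such sets: then the maximal
    elements are among the [n] unions of all vectors of [S] vanishing at a
    given coordinate.  Conversely, a hypergraph of dimension [k] is recovered
    in this way from the list of its independent sets of size at most [k].

    Polynomial time is obtained from a small language in which every loop has
    as many iterations as the input has bits, so that every program runs in
    polynomial time. *)

Require Import Defs.
From mathcomp Require Import all_boot zify.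

Set Implicit Arguments.
Unset Strict Implicit.
Unset Printing Implicit Defensive.

(** * A loop language compiled to random access machines *)

(** The size of both reductions is polynomial because [k] is fixed: the sets of at most [k]
    coordinates are run through by [k] nested loops bounded by the input length, which exceeds the
    dimension since the dimension is encoded in unary. Translating one solution back prints at most
    linearly many vectors in polynomial total time, so no finer control of the delay is needed. Two
    mismatches shape the constructions. The dimension has to be exactly [k], although the uncovered
    sets may all be smaller or absent; the edge added to force it splits every maximal independent
    set into [k] variants, and disjointness of the translations requires all but one of them to
    yield nothing. The closure problem excludes the vectors 0 and 1, whereas the empty or the full
    set may well be maximal; the full set then stands for the whole list of unions, from which
    repetitions have to be removed. *)

Inductive expr : Type :=
| EVar of nat
| ECst of nat
| EAdd of expr & expr
| ESub of expr & expr
| EMem of expr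
| EIf of expr & expr
| ESum of nat & expr.

Inductive cmd : Type :=
| CSkip
| CWrite of expr
| CEmit
| CSeq of cmd & cmd
| CIf of expr & cmd
| CFor of nat & cmd.

(* [N] is the length of the input, which bounds every sum and every loop. *)
Fixpoint den (N : nat) (M env : nat -> nat) (e : expr) : nat :=
  match e with
  | EVar x => env x
  | ECst n => n
  | EAdd a b => den N M env a + den N M env b
  | ESub a b => den N M env a - den N M env b
  | EMem a => M (den N M env a)
  | EIf a b => if den N M env a == 0 then 0 else den N M env b
  | ESum x a => \sum_(0 <= j < N) den N M [eta env with x |-> j] a
  end.

(* [Some b] stands for a written bit, [None] for the end of a word. *)
Fixpoint eval (N : nat) (M env : nat -> nat) (c : cmd) : seq (option bool) :=
  match c with
  | CSkip => [::]
  | CWrite e => [:: Some (den N M env e != 0)]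
  | CEmit => [:: None]
  | CSeq a b => eval N M env a ++ eval N M env b
  | CIf e a => if den N M env e == 0 then [::] else eval N M env a
  | CFor x a => flatten [seq eval N M [eta env with x |-> j] a | j <- iota 0 N]
  end.

Definition record_event (s : word * seq word) (ev : option bool) :=
  if ev is Some b then (rcons s.1 b, s.2) else ([::], rcons s.2 s.1).

Definition outputs (evs : seq (option bool)) : seq word :=
  (foldl record_event ([::], [::]) evs).2.

(* The code is placed at address [p], variable [x] lives in register [rho x],
   and only the registers from [d] on are modified; the value of the
   expression ends up in register [d]. *)
Fixpoint comp_expr (rho : nat -> nat) (d p : nat) (e : expr) : seq instr :=
  match e with
  | EVar x => [:: IConst d 0; IAdd d d (rho x)]
  | ECst n => [:: IConst d n]
  | EAdd a b =>
      let ca := comp_expr rho d p a in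
      let cb := comp_expr rho d.+1 (p + size ca) b in
      ca ++ cb ++ [:: IAdd d d d.+1]
  | ESub a b =>
      let ca := comp_expr rho d p a in
      let cb := comp_expr rho d.+1 (p + size ca) b in
      ca ++ cb ++ [:: ISub d d d.+1]
  | EMem a => comp_expr rho d p a ++ [:: ILoad d d]
  | EIf a b =>
      let ca := comp_expr rho d p a in
      let cb := comp_expr rho d (p + size ca).+1 b in
      ca ++ IJz d ((p + size ca).+1 + size cb) :: cb
  | ESum x a =>
      let ca := comp_expr [eta rho with x |-> d.+1] d.+2 p.+4 a in
      [:: IConst d 0; IConst d.+1 0; ISub d.+2 0 d.+1;
          IJz d.+2 (p.+4 + size ca + 5)] ++
      ca ++
      [:: IAdd d d d.+2; IConst d.+2 1; IAdd d.+1 d.+1 d.+2; IConst d.+2 0;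
          IJz d.+2 p.+2]
  end.

Fixpoint comp_cmd (rho : nat -> nat) (d p : nat) (c : cmd) : seq instr :=
  match c with
  | CSkip => [::]
  | CWrite e => comp_expr rho d p e ++ [:: IWrite d]
  | CEmit => [:: IEmit]
  | CSeq a b =>
      let ca := comp_cmd rho d p a in
      ca ++ comp_cmd rho d (p + size ca) b
  | CIf e a =>
      let ce := comp_expr rho d p e in
      let ca := comp_cmd rho d (p + size ce).+1 a in
      ce ++ IJz d ((p + size ce).+1 + size ca) :: ca
  | CFor x a =>
      let ca := comp_cmd [eta rho with x |-> d] d.+1 p.+3 a in
      [:: IConst d 0; ISub d.+1 0 d; IJz d.+1 (p.+3 + size ca + 4)] ++
      ca ++
      [:: IConst d.+1 1; IAdd d d d.+1; IConst d.+1 0; IJz d.+1 p.+1]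
  end.

(* Register 1 is never written, so it provides the value 0 of the variables
   that are not bound. *)
Definition compile (c : cmd) : program := comp_cmd (fun=> 1) 2 0 c.

(** Bounds on the number of executed instructions. An iteration of [ESum] adds 7 to its body: two
    for the test of [N - j], five to accumulate, increment and jump back; the 4 counts two
    initialisations and the final test. Without accumulator, [CFor] has 6 and 3 instead. *)
Fixpoint time_expr (N : nat) (e : expr) : nat :=
  match e with
  | EVar _ => 2
  | ECst _ => 1
  | EAdd a b | ESub a b | EIf a b => time_expr N a + time_expr N b + 1
  | EMem a => time_expr N a + 1
  | ESum _ a => N * (time_expr N a + 7) + 4
  end.

Fixpoint time_cmd (N : nat) (c : cmd) : nat :=
  match c with
  | CSkip => 0
  | CWrite e => time_expr N e + 1
  | CEmit => 1
  | CSeq a b => time_cmd N a + time_cmd N b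
  | CIf e a => time_expr N e + time_cmd N a + 1
  | CFor _ a => N * (time_cmd N a + 6) + 3
  end.

(** * Correctness of the compiler *)

Fixpoint code_at (P : program) (p : nat) (l : seq instr) : Prop :=
  if l is i :: l' then onth P p = Some i /\ code_at P p.+1 l' else True.

Lemma code_at_cat (P : program) (p : nat) (l1 l2 : seq instr) :
  code_at P p (l1 ++ l2) -> code_at P p l1 /\ code_at P (p + size l1) l2.
Proof.
elim: l1 p => [|i l1 IH] p /=; first by rewrite addn0.
by case=> -> /IH []; rewrite addSnnS.
Qed.

Lemma code_at_self (P Q : program) : code_at (Q ++ P) (size Q) P.
Proof.
elim: P Q => [|i P IH] Q //=; split; last by rewrite -cat_rcons -(size_rcons Q i).
by elim: Q.
Qed.

(** A bound instead of an exact count lets the two outcomes of a conditional share one estimate. *)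
Definition reaches (P : program) (n : nat) (s s' : config) : Prop :=
  exists2 t, t <= n & iter t (step P) s = s'.

Lemma reaches_refl (P : program) (n : nat) (s : config) : reaches P n s s.
Proof. by exists 0. Qed.

Lemma reaches_pc (P : program) (n p p' : nat) (s : config) (R M : nat -> nat)
    (b : word) (o : seq (nat * word)) (k : nat) :
  p = p' -> reaches P n s (Config p R M b o k) ->
  reaches P n s (Config p' R M b o k).
Proof. by move->. Qed.

Lemma reaches_trans (P : program) (m n : nat) (s1 s2 s3 : config) :
  reaches P m s1 s2 -> reaches P n s2 s3 -> reaches P (m + n) s1 s3.
Proof.
move=> [t tm <-] [u un <-]; exists (u + t); first by lia.
by rewrite iterD.
Qed.

Lemma reaches_weaken (P : program) (m n : nat) (s s' : config) :
  m <= n -> reaches P m s s' -> reaches P n s s'.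
Proof. by move=> mn [t tm <-]; exists t => //; apply: leq_trans mn. Qed.

Lemma reaches_step (P : program) (i : instr) (n : nat) (s s' : config) :
  onth P (pc s) = Some i -> reaches P n (exec i s) s' -> reaches P n.+1 s s'.
Proof.
move=> Pi [t tn <-]; exists t.+1 => //.
by rewrite iterSr {2}/step Pi.
Qed.

Lemma eta_eq (f : nat -> nat) (x v : nat) : [eta f with x |-> v] x = v.
Proof. by rewrite /= eqxx. Qed.

Lemma eta_neq (f : nat -> nat) (x y v : nat) :
  y != x -> [eta f with x |-> v] y = f y.
Proof. by rewrite /= => /negbTE ->. Qed.

Lemma neqSn (n : nat) : (n.+1 == n) = false. Proof. lia. Qed.
Lemma neqnS (n : nat) : (n == n.+1) = false. Proof. lia. Qed.
Lemma neqSSn (n : nat) : (n.+2 == n) = false. Proof. lia. Qed.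
Lemma neqnSS (n : nat) : (n == n.+2) = false. Proof. lia. Qed.
Lemma neq0S (n : nat) : (0 == n.+1) = false. Proof. by []. Qed.
Definition neqE := (eqxx, neqSn, neqnS, neqSSn, neqnSS, neq0S).

Arguments onth : simpl never.

Ltac one_step H := apply: reaches_step; [exact: H | rewrite /exec /=].

(** Preservation of the registers below [d] carries the induction: they hold the loop bound, the
    variables and the left operands still waiting. *)
Lemma comp_exprP (P : program) (N : nat) (M : nat -> nat) (b : word)
    (o : seq (nat * word)) (e : expr) (rho : nat -> nat) (d p : nat)
    (env R : nat -> nat) (k : nat) :
  0 < d -> code_at P p (comp_expr rho d p e) -> (forall x, rho x < d) ->
  R 0 = N -> (forall x, R (rho x) = env x) ->
  exists R' k', [/\ reaches P (time_expr N e) (Config p R M b o k)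
                      (Config (p + size (comp_expr rho d p e)) R' M b o k'),
                    R' d = den N M env e & forall r, r < d -> R' r = R r].
Proof.
elim: e rho d p env R k => [x|n|a IHa c IHc|a IHa c IHc|a IHa|a IHa c IHc|x a IHa]
  rho d p env R k d0 /=.
- move=> [H1 [H2 _]] rd R0 Rr.
  exists [eta [eta R with d |-> 0] with
    d |-> [eta R with d |-> 0] d + [eta R with d |-> 0] (rho x)].
  eexists; split.
  + one_step H1; one_step H2; rewrite addn2; exact: reaches_refl.
  + by rewrite /= !eqxx add0n; have := rd x; case: eqP => [->|_]; rewrite ?ltnn // Rr.
  + by move=> r rltd; rewrite /=; have /negbTE -> : r != d by lia.
- move=> [H1 _] rd R0 Rr; exists [eta R with d |-> n]; eexists; split.
  + one_step H1; rewrite addn1; exact: reaches_refl.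
  + exact: eta_eq.
  + by move=> r rltd; rewrite eta_neq //; lia.
- move=> /code_at_cat [Ha /code_at_cat [Hc [H1 _]]] rd R0 Rr.
  have [R1 [k1 [E1 V1 L1]]] := IHa _ _ _ env R k d0 Ha rd R0 Rr.
  have [| | |x|R2 [k2 [E2 V2 L2]]] := IHc _ _ _ env R1 k1 _ Hc.
  + by [].
  + by move=> x; apply: leqW.
  + by rewrite L1.
  + by rewrite L1.
  exists [eta R2 with d |-> R2 d + R2 d.+1]; eexists; split.
  + apply: reaches_trans (reaches_trans E1 E2) _.
    one_step H1; by apply: reaches_pc (reaches_refl _ _ _); rewrite ?size_cat /=; lia.
  + by rewrite eta_eq V2 L2 // V1.
  + by move=> r rltd; rewrite eta_neq ?L2 ?L1 //; lia.
- move=> /code_at_cat [Ha /code_at_cat [Hc [H1 _]]] rd R0 Rr.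
  have [R1 [k1 [E1 V1 L1]]] := IHa _ _ _ env R k d0 Ha rd R0 Rr.
  have [| | |x|R2 [k2 [E2 V2 L2]]] := IHc _ _ _ env R1 k1 _ Hc.
  + by [].
  + by move=> x; apply: leqW.
  + by rewrite L1.
  + by rewrite L1.
  exists [eta R2 with d |-> R2 d - R2 d.+1]; eexists; split.
  + apply: reaches_trans (reaches_trans E1 E2) _.
    one_step H1; by apply: reaches_pc (reaches_refl _ _ _); rewrite ?size_cat /=; lia.
  + by rewrite eta_eq V2 L2 // V1.
  + by move=> r rltd; rewrite eta_neq ?L2 ?L1 //; lia.
- move=> /code_at_cat [Ha [H1 _]] rd R0 Rr.
  have [R1 [k1 [E1 V1 L1]]] := IHa _ _ _ env R k d0 Ha rd R0 Rr.
  exists [eta R1 with d |-> M (R1 d)]; eexists; split.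
  + apply: reaches_trans E1 _.
    one_step H1; by apply: reaches_pc (reaches_refl _ _ _); rewrite ?size_cat /=; lia.
  + by rewrite eta_eq V1.
  + by move=> r rltd; rewrite eta_neq ?L1 //; lia.
- move=> /code_at_cat [Ha [H1 Hc]] rd R0 Rr.
  have [R1 [k1 [E1 V1 L1]]] := IHa _ _ _ env R k d0 Ha rd R0 Rr.
  have [Ez|Enz] := eqVneq (den N M env a) 0.
    exists R1; eexists; split => //; last by rewrite V1.
    apply: (@reaches_weaken _ (time_expr N a + 1)); first by lia.
    apply: reaches_trans E1 _; one_step H1.
    rewrite V1 Ez eqxx; by apply: reaches_pc (reaches_refl _ _ _); rewrite ?size_cat /=; lia.
  have [|x|R2 [k2 [E2 V2 L2]]] := IHc _ _ _ env R1
    (k1 + bitlen (R1 d)) d0 Hc rd; rewrite ?L1 //.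
  exists R2, k2; split => //; last by move=> r rltd; rewrite L2 // L1.
  rewrite -addnA; apply: reaches_trans E1 _.
  rewrite addn1; one_step H1; rewrite V1 (negbTE Enz) -V1.
  by apply: reaches_pc E2; rewrite size_cat /=; lia.
- move=> [H1 [H2 [H3 [H4 /code_at_cat [Ha [H5 [H6 [H7 [H8 [H9 _]]]]]]]]]] rd R0 Rr.
  set ca := comp_expr _ _ _ _ in H4 Ha H5 H6 H7 H8 H9 *.
  set body := fun j => den N M [eta env with x |-> j] a.
  (* [m] iterations remain and [p.+2] is the address of the loop test; register [d] holds the
     partial sum, [d.+1] the counter. *)
  suff loop m j R1 k1 : m + j = N -> R1 0 = N -> R1 d.+1 = j ->
      R1 d = \sum_(0 <= i < j) body i -> (forall r, r < d -> R1 r = R r) ->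
      exists R' k', [/\ reaches P (m * (time_expr N a + 7) + 2)
          (Config p.+2 R1 M b o k1) (Config (p.+4 + size ca + 5) R' M b o k'),
          R' d = \sum_(0 <= i < N) body i & forall r, r < d -> R' r = R r].
    have [||||r rd'|R' [k' [E V L]]] := loop N 0 [eta [eta R with d |-> 0] with d.+1 |-> 0]
        (k + cost (IConst d 0) R M + cost (IConst d.+1 0) [eta R with d |-> 0] M).
    + by rewrite addn0.
    + by rewrite !eta_neq //; lia.
    + exact: eta_eq.
    + by rewrite eta_neq ?eta_eq ?big_nil ?neqE.
    + by rewrite !eta_neq //; lia.
    exists R', k'; split => //.
    rewrite addnS addnS; one_step H1; one_step H2.
    by apply: reaches_pc E; rewrite size_cat /=; lia.
  elim: m j R1 k1 => [|m IHm] j R1 k1 mj R10 R1j R1s R1r.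
    exists [eta R1 with d.+2 |-> R1 0 - R1 d.+1]; eexists; split.
    + one_step H3; one_step H4.
      rewrite eqxx /= R10 R1j -mj add0n subnn /=; exact: reaches_refl.
    + by rewrite /= neqE R1s -mj.
    + by move=> r rltd; rewrite eta_neq ?R1r //; lia.
  set R2 := [eta R1 with d.+2 |-> R1 0 - R1 d.+1].
  set k2 := k1 + (bitlen (R1 0) + bitlen (R1 d.+1)) + bitlen (R1 0 - R1 d.+1).
  have [|y| |y|R3 [k3 [E3 V3 L3]]] := IHa _ _ _ [eta env with x |-> j] R2 k2 _ Ha.
  + by [].
  + by rewrite /=; case: ifP => // _; apply: leq_trans (rd y) _; lia.
  + by rewrite /R2 /= .
  + rewrite /R2 /=; case: (y == x); first by rewrite neqE R1j.
    have rdy := rd y; have /negbTE -> : rho y != d.+2 by lia.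
    by rewrite R1r.
  have [||||r rd'|R' [k' [E V L]]] := IHm j.+1
   [eta [eta [eta [eta R3 with d |-> R3 d + R3 d.+2]
     with d.+2 |-> 1] with d.+1 |-> R3 d.+1 + 1] with d.+2 |-> 0]
   (k3 + (bitlen (R3 d) + bitlen (R3 d.+2)) + bitlen 1 +
    (bitlen (R3 d.+1) + bitlen 1) + bitlen 0 + bitlen 0).
  + by rewrite addnS -addSn.
  + by rewrite !eta_neq ?L3 /R2 ?eta_neq ?R10 //; lia.
  + by rewrite /= !neqE L3 // /R2 /= neqE R1j addn1.
  + rewrite /= !neqE L3 /R2 /= ?neqE; last by lia.
    by rewrite R1s V3 big_nat_recr.
  + by rewrite !eta_neq ?L3 /R2 ?eta_neq ?R1r //; lia.
  exists R', k'; split => //.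
  apply: (@reaches_weaken _
    (2 + (time_expr N a + (5 + (m * (time_expr N a + 7) + 2))))); first by lia.
  rewrite add2n; one_step H3; one_step H4; rewrite neqE /=.
  have -> : (R1 0 - R1 d.+1 == 0) = false by lia.
  apply: reaches_trans E3 _.
  rewrite !addSn add0n; one_step H5; one_step H6; one_step H7; one_step H8; one_step H9.
  by rewrite !neqE; exact: E.
Qed.

(** Only the words are tracked; the stamps in [o'] stay unspecified, since they are bounded later
    through the clock. *)
Lemma comp_cmdP (P : program) (N : nat) (M : nat -> nat) (c : cmd)
    (rho : nat -> nat) (d p : nat) (env R : nat -> nat) (b : word)
    (o : seq (nat * word)) (k : nat) :
  0 < d -> code_at P p (comp_cmd rho d p c) -> (forall x, rho x < d) ->
  R 0 = N -> (forall x, R (rho x) = env x) ->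
  exists R' b' o' k',
    [/\ reaches P (time_cmd N c) (Config p R M b o k)
          (Config (p + size (comp_cmd rho d p c)) R' M b' o' k'),
        (b', unzip2 o') = foldl record_event (b, unzip2 o) (eval N M env c)
      & forall r, r < d -> R' r = R r].
Proof.
elim: c rho d p env R b o k => [|e||a IHa c IHc|e a IHa|x a IHa]
  rho d p env R b o k d0 /=.
- move=> _ rd R0 Rr; exists R, b, o, k; split => //.
  by rewrite addn0; exact: reaches_refl.
- move=> /code_at_cat [Ha [H1 _]] rd R0 Rr.
  have [R1 [k1 [E1 V1 L1]]] := comp_exprP M b o k d0 Ha rd R0 Rr.
  exists R1, (rcons b (R1 d != 0)), o; eexists; split => //; last by rewrite V1.
  apply: reaches_trans E1 _; one_step H1.
  by apply: reaches_pc (reaches_refl _ _ _); rewrite size_cat /=; lia.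
- move=> [H1 _] rd R0 Rr; exists R, [::]; do 2!eexists; split => //.
  + one_step H1.
    by apply: reaches_pc (reaches_refl _ _ _); rewrite /=; lia.
  + by rewrite /unzip2 map_rcons.
- move=> /code_at_cat [Ha Hc] rd R0 Rr.
  have [R1 [b1 [o1 [k1 [E1 V1 L1]]]]] := IHa _ _ _ env R b o k d0 Ha rd R0 Rr.
  have [|x|R2 [b2 [o2 [k2 [E2 V2 L2]]]]] := IHc _ _ _ env R1 b1 o1 k1 d0 Hc rd;
    rewrite ?L1 //.
  exists R2, b2, o2, k2; split.
  + by apply: reaches_trans E1 _; apply: reaches_pc E2; rewrite size_cat; lia.
  + by rewrite foldl_cat -V1.
  + by move=> r rltd; rewrite L2 // L1.
- move=> /code_at_cat [He [H1 Ha]] rd R0 Rr.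
  have [R1 [k1 [E1 V1 L1]]] := comp_exprP M b o k d0 He rd R0 Rr.
  have [Ez|Enz] := eqVneq (den N M env e) 0.
    exists R1, b, o; eexists; split => //.
    apply: (@reaches_weaken _ (time_expr N e + 1)); first by lia.
    apply: reaches_trans E1 _; one_step H1.
    rewrite V1 Ez eqxx.
    by apply: reaches_pc (reaches_refl _ _ _); rewrite size_cat /=; lia.
  have [|x|R2 [b2 [o2 [k2 [E2 V2 L2]]]]] := IHa _ _ _ env R1 b o
    (k1 + bitlen (R1 d)) d0 Ha rd; rewrite ?L1 //.
  exists R2, b2, o2, k2; split => //; last by move=> r rltd; rewrite L2 // L1.
  rewrite -addnA; apply: reaches_trans E1 _.
  rewrite addn1; one_step H1; rewrite V1 (negbTE Enz) -V1.
  by apply: reaches_pc E2; rewrite size_cat /=; lia.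
- move=> [H1 [H2 [H3 /code_at_cat [Ha [H4 [H5 [H6 [H7 _]]]]]]]] rd R0 Rr.
  set ca := comp_cmd _ _ _ _ in H3 Ha H4 H5 H6 H7 *.
  set body := fun j => eval N M [eta env with x |-> j] a.
  suff loop m j R1 b1 o1 k1 : m + j = N -> R1 0 = N -> R1 d = j ->
      (forall r, r < d -> R1 r = R r) ->
      exists R' b' o' k', [/\ reaches P (m * (time_cmd N a + 6) + 2)
          (Config p.+1 R1 M b1 o1 k1) (Config (p.+3 + size ca + 4) R' M b' o' k'),
          (b', unzip2 o') = foldl record_event (b1, unzip2 o1)
            (flatten [seq body i | i <- iota j m])
        & forall r, r < d -> R' r = R r].
    have [|||r rd'|R' [b' [o' [k' [E V L]]]]] :=
        loop N 0 [eta R with d |-> 0] b o (k + cost (IConst d 0) R M).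
    + by rewrite addn0.
    + by rewrite eta_neq //; lia.
    + exact: eta_eq.
    + by rewrite !eta_neq //; lia.
    exists R', b', o', k'; split => //.
    rewrite addnS; one_step H1.
    by apply: reaches_pc E; rewrite size_cat /=; lia.
  elim: m j R1 b1 o1 k1 => [|m IHm] j R1 b1 o1 k1 mj R10 R1j R1r.
    exists [eta R1 with d.+1 |-> R1 0 - R1 d], b1, o1; eexists; split => //.
    + one_step H2; one_step H3.
      rewrite eqxx /= R10 R1j -mj add0n subnn /=; exact: reaches_refl.
    + by move=> r rltd; rewrite eta_neq ?R1r //; lia.
  set R2 := [eta R1 with d.+1 |-> R1 0 - R1 d].
  set k2 := k1 + (bitlen (R1 0) + bitlen (R1 d)) + bitlen (R1 0 - R1 d).
  have [|y| |y|R3 [b3 [o3 [k3 [E3 V3 L3]]]]] :=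
    IHa _ _ _ [eta env with x |-> j] R2 b1 o1 k2 _ Ha.
  + by [].
  + by rewrite /=; case: ifP => // _; apply: leq_trans (rd y) _; lia.
  + by rewrite /R2 /= .
  + rewrite /R2 /=; case: (y == x); first by rewrite neqE R1j.
    have rdy := rd y; have /negbTE -> : rho y != d.+1 by lia.
    by rewrite R1r.
  have [|||r rd'|R' [b' [o' [k' [E V L]]]]] := IHm j.+1
    [eta [eta [eta R3 with d.+1 |-> 1] with d |-> R3 d + 1] with d.+1 |-> 0] b3 o3
    (k3 + bitlen 1 + (bitlen (R3 d) + bitlen 1) + bitlen 0 + bitlen 0).
  + by rewrite addnS -addSn.
  + by rewrite !eta_neq ?L3 /R2 ?eta_neq ?R10 //; lia.
  + by rewrite /= !neqE L3 // /R2 /= neqE R1j addn1.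
  + by rewrite !eta_neq ?L3 /R2 ?eta_neq ?R1r //; lia.
  exists R', b', o', k'; split => //; last by rewrite /= foldl_cat -V3.
  apply: (@reaches_weaken _
    (2 + (time_cmd N a + (4 + (m * (time_cmd N a + 6) + 2))))); first by lia.
  rewrite add2n; one_step H2; one_step H3; rewrite neqE /=.
  have -> : (R1 0 - R1 d == 0) = false by lia.
  apply: reaches_trans E3 _.
  rewrite !addSn add0n; one_step H4; one_step H5; one_step H6; one_step H7.
  by rewrite !neqE; exact: E.
Qed.

Lemma compileP (c : cmd) (w : word) :
  exists2 t, t <= time_cmd (size w) c &
    halted (compile c) (run (compile c) w t) /\
    unzip2 (outs (run (compile c) w t)) =
      outputs (eval (size w) (fun a => nth false w a) (fun=> 0) c).
Proof.
have := @comp_cmdP (compile c) (size w) (fun a => nth false w a) c (fun=> 1) 2 0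
  (fun=> 0) [eta (fun=> 0) with 0 |-> size w] [::] [::] 0 isT.
move/(_ (code_at_self _ [::]) (fun=> isT) (erefl _) (fun=> erefl _)).
move=> [R' [b' [o' [k' [[t tle E] V _]]]]]; exists t => //.
by rewrite /run /init E /halted leqnn /outputs -V.
Qed.

(** * Polynomial bounds *)

Definition pbounded (f : nat -> nat) : Prop :=
  exists c, forall n, f n <= polybound c n.

Lemma pbounded_const (a : nat) : pbounded (fun=> a).
Proof. by exists a => n; rewrite /polybound leq_addl. Qed.

Lemma pbounded_id : pbounded id.
Proof. by exists 1 => n; rewrite /polybound expn1; lia. Qed.

Lemma pbounded_add (f g : nat -> nat) :
  pbounded f -> pbounded g -> pbounded (fun n => f n + g n).
Proof.
move=> [a fa] [b gb]; exists (a + b) => n.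
apply: leq_trans (leq_add (fa n) (gb n)) _; rewrite /polybound.
(* Powers of 0 are not monotone in the exponent, as [0 ^ 0 = 1]; but [c * 0 ^ c] vanishes for every
   [c]. *)
case: n {fa gb} => [|n].
  have H c : c * 0 ^ c = 0 by case: c => // c; rewrite exp0n // muln0.
  by rewrite !H.
have := leq_pexp2l (isT : 0 < n.+1) (leq_addr b a).
have := leq_pexp2l (isT : 0 < n.+1) (leq_addl a b).
nia.
Qed.

Lemma pbounded_mul (f g : nat -> nat) :
  pbounded f -> pbounded g -> pbounded (fun n => f n * g n).
Proof.
(* With [x] and [y] the two powers, both at least 1, the product is [a * b * (x.+1 * y.+1)], at most
   [4 * a * b * (x * y)]. The chosen number also exceeds [a + b], so it serves as exponent too. *)
move=> [a fa] [b gb]; exists (4 * (a.+1 * b.+1)) => n.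
apply: leq_trans (leq_mul (fa n) (gb n)) _; rewrite /polybound.
case: n {fa gb} => [|n].
  have H c : c * 0 ^ c = 0 by case: c => // c; rewrite exp0n // muln0.
  by rewrite !H; nia.
set x := n.+1 ^ a; set y := n.+1 ^ b; set z := n.+1 ^ _.
have x0 : 0 < x by rewrite expn_gt0.
have y0 : 0 < y by rewrite expn_gt0.
have : x * y <= z by rewrite -expnD leq_pexp2l //; nia.
move: x y z x0 y0 => x y z x0 y0 xyz.
suff : (a * x + a) * (b * y + b) <= 4 * (a.+1 * b.+1) * (x * y) by nia.
have -> : (a * x + a) * (b * y + b) = (a * b) * (x.+1 * y.+1) by nia.
have : x.+1 * y.+1 <= 4 * (x * y) by nia.
have : a * b <= a.+1 * b.+1 by nia.
by move=> H1 H2; apply: leq_trans (leq_mul H1 H2) _; rewrite mulnA (mulnC _ 4).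
Qed.

Lemma pbounded_time_expr (e : expr) : pbounded (fun N => time_expr N e).
Proof.
elim: e => [x|n|a IHa b IHb|a IHa b IHb|a IHa|a IHa b IHb|x a IHa] /=;
  by repeat first [apply: pbounded_add | apply: pbounded_mul | assumption
    | exact: pbounded_const | exact: pbounded_id].
Qed.

Lemma pbounded_time_cmd (c : cmd) : pbounded (fun N => time_cmd N c).
Proof.
elim: c => [|e||a IHa b IHb|e a IHa|x a IHa] /=;
  by repeat first [apply: pbounded_add | apply: pbounded_mul | assumption
    | exact: pbounded_const | exact: pbounded_id | exact: pbounded_time_expr].
Qed.

Definition const_bound (P : program) : nat :=
  \max_(i <- P) if i is IConst _ n then n else 0.

Lemma const_bound_onth (P : program) (p r n : nat) :
  onth P p = Some (IConst r n) -> n <= const_bound P.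
Proof.
rewrite /const_bound; elim: P p => [|i P IH] [|p] //; rewrite big_cons.
  by case=> ->; rewrite leq_maxl.
by move/IH => le; rewrite leq_max le orbT.
Qed.

Lemma bitlen_le (x a t : nat) : x <= a * 2 ^ t -> bitlen x <= (a + t).+1.
Proof.
move=> xat; rewrite ltnS -(@trunc_expnK 2 (a + t)) //; apply: leq_trunc_log.
by apply: leq_trans xat _; rewrite expnD leq_mul2r ltnW ?orbT // ltn_expl.
Qed.

(* A step at most doubles the largest value present, so the bit length of
   the values, hence the cost of a step, grows at most linearly in the number
   of steps. *)
Lemma clock_le (P : program) (w : word) (t : nat) :
  let s := run P w t in
  let a := (const_bound P + size w).+1 in
  [/\ forall r, reg s r <= a * 2 ^ t, forall r, Defs.mem s r <= a * 2 ^ t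
    & clock s <= t * (2 * (a + t).+1)].
Proof.
rewrite /=; set a := _.+1; elim: t => [|t [IHr IHm IHc]] /=.
  split=> // r; rewrite muln1 /a /=; last by case: nth.
  by case: eqP => // _; lia.
rewrite -/(run P w t) /step; case: (run P w t) IHr IHm IHc => p R M b o k /= IHr IHm IHc.
have le2 x : x <= 2 * (a * 2 ^ t) -> x <= a * 2 ^ t.+1.
  by rewrite expnS mulnCA.
have leR r : R r <= a * 2 ^ t.+1 by apply: le2; have := IHr r; lia.
have leM r : M r <= a * 2 ^ t.+1 by apply: le2; have := IHm r; lia.
have clk x : x <= 2 * (a + t).+1 -> k + x <= t.+1 * (2 * (a + t.+1).+1) by nia.
have lR r : bitlen (R r) <= (a + t).+1 by apply: bitlen_le.
have lM r : bitlen (M r) <= (a + t).+1 by apply: bitlen_le.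
have clk2 x y : x <= (a + t).+1 -> y <= (a + t).+1 ->
    k + (x + y) <= t.+1 * (2 * (a + t.+1).+1) by move=> *; apply: clk; lia.
have clk1 x : x <= (a + t).+1 -> k + x <= t.+1 * (2 * (a + t.+1).+1).
  by move=> *; apply: clk; lia.
case Ei: (onth P p) => [i|] /=; last by split=> //; nia.
have le_a n : n <= const_bound P -> n <= a * 2 ^ t.
  move=> nP; apply: leq_trans (_ : a * 1 <= _); first by rewrite /a; lia.
  by rewrite leq_mul2l expn_gt0 orbT.
case: i Ei => [r n|r s u|r s u|r s|r s|r l|r|] Ei /=;
  split=> /=; try move=> x; try (by []); try (by case: ifP); try (by apply: clk2);
  try (by apply: clk1).
- by case: ifP => // _; apply: le2; have := le_a _ (const_bound_onth Ei); lia.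
- by apply: clk1; apply: bitlen_le; apply: le_a; apply: const_bound_onth Ei.
- by case: ifP => // _; apply: le2; have := IHr s; have := IHr u; lia.
- by case: ifP => // _; apply: le2; have := IHr s; lia.
Qed.

(** The clock never decreases. *)
Lemma stamps_le (P : program) (w : word) (t : nat) :
  all (fun s => s <= clock (run P w t)) (unzip1 (outs (run P w t))).
Proof.
elim: t => [|t] //=; rewrite -/(run P w t) /step.
case: (run P w t) => p R M b o k /= IH.
case: (onth P p) => [i|] //.
have IH' x : all (fun s => s <= k + x) (unzip1 o).
  by apply: sub_all IH => y; lia.
by case: i => *; rewrite /= ?IH' // /unzip1 map_rcons all_rcons leqnn IH'.
Qed.

Lemma compile_poly (c : cmd) : exists b, forall w, exists t,
  let final := run (compile c) w t in
  [/\ halted (compile c) final,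
      unzip2 (outs final) =
        outputs (eval (size w) (fun a => nth false w a) (fun=> 0) c),
      clock final <= polybound b (size w)
    & all (fun s => s <= polybound b (size w)) (unzip1 (outs final))].
Proof.
have [b Hb] : pbounded (fun N => time_cmd N c *
    (2 * (const_bound (compile c) + N + time_cmd N c + 2))).
  have H := pbounded_time_cmd c.
  by repeat first [apply: pbounded_add | apply: pbounded_mul | assumption
    | exact: pbounded_const | exact: pbounded_id].
exists b => w; have [t tle [halt out]] := compileP c w; exists t.
have [_ _ ck] := clock_le (compile c) w t.
have ckb : clock (run (compile c) w t) <= polybound b (size w).
  by apply: leq_trans ck (leq_trans _ (Hb _)); nia.
split=> //; apply: sub_all (stamps_le (compile c) w t) => s /leq_trans; exact.
Qed.

(** * Vectors closed under a threshold function *)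

Definition ones (n : nat) (v : n.-tuple bool) : {set 'I_n} := [set i | tnth v i].

Definition covered (n : nat) (S : seq (n.-tuple bool)) (T : {set 'I_n}) : bool :=
  has (fun s => T \subset ones s) S.

(** [T] may be empty, so nothing is [kcovered] when [S] is empty, in accordance with the closure
    being empty then. *)
Definition kcovered (k n : nat) (S : seq (n.-tuple bool)) (I : {set 'I_n}) : bool :=
  [forall T : {set 'I_n}, (T \subset I) ==> (#|T| <= k) ==> covered S T].

(* The constraints preserved by [Th k k.+1]: a bound on the sets of ones,
   the implications between coordinates, and the coordinates that are
   constantly 1. *)
Definition feasible (k n : nat) (S : seq (n.-tuple bool)) (v : n.-tuple bool) : Prop :=
  [/\ kcovered k S (ones v),
      forall t z, tnth v t -> ~~ tnth v z ->
        exists2 s, s \in S & tnth s t && ~~ tnth s z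
    & forall z, ~~ tnth v z -> exists2 s, s \in S & ~~ tnth s z].

Definition th_apply (k n : nat) (vs : 'I_k.+1 -> n.-tuple bool) : n.-tuple bool :=
  [tuple Th k k.+1 [tuple tnth (vs i) j | i < k.+1] | j < n].

Lemma kcoveredP (k n : nat) (S : seq (n.-tuple bool)) (I : {set 'I_n}) :
  reflect (forall T : {set 'I_n}, T \subset I -> #|T| <= k ->
             exists2 s, s \in S & T \subset ones s)
    (kcovered k S I).
Proof.
apply: (iffP forallP) => H T.
  by move=> TI Tk; have := H T; rewrite TI Tk => /hasP.
by apply/implyP => TI; apply/implyP => Tk; apply/hasP; apply: H.
Qed.

Lemma kcovered_sub (k n : nat) (S : seq (n.-tuple bool)) (I J : {set 'I_n}) :
  I \subset J -> kcovered k S J -> kcovered k S I.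
Proof.
move=> IJ /kcoveredP H; apply/kcoveredP => T TI.
by apply: H; apply: subset_trans IJ.
Qed.

Lemma count_mktuple (m : nat) (f : 'I_m -> bool) :
  count id [tuple f i | i < m] = #|[set i | f i]|.
Proof.
rewrite cardsE cardE count_map val_ord_tuple -size_filter /enum_mem.
by rewrite -filter_predI; congr size; apply: eq_filter => i /=; rewrite andbT.
Qed.

Lemma tnth_th_apply (k n : nat) (vs : 'I_k.+1 -> n.-tuple bool) (j : 'I_n) :
  tnth (th_apply vs) j = (k <= #|[set i | tnth (vs i) j]|).
Proof. by rewrite tnth_mktuple ffunE count_mktuple. Qed.

Lemma th_applyE (k n : nat) (vs : 'I_k.+1 -> n.-tuple bool) (j : 'I_n) :
  tnth (th_apply vs) j = (#|[set i | ~~ tnth (vs i) j]| <= 1).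
Proof.
rewrite tnth_th_apply; have := cardsC [set i | tnth (vs i) j].
have -> : ~: [set i | tnth (vs i) j] = [set i | ~~ tnth (vs i) j].
  by apply/setP => i; rewrite !inE.
by rewrite card_ord; lia.
Qed.

(** Induction on the term that builds [f] from the threshold function: a composition is applied
    layer by layer through the intermediate vectors [us], so only the generator has to be
    checked. *)
Lemma Cl_S10_ind (k n : nat) (S : seq (n.-tuple bool)) (P : n.-tuple bool -> Prop) :
  (forall v, v \in S -> P v) ->
  (forall vs : 'I_k.+1 -> n.-tuple bool, (forall i, P (vs i)) -> P (th_apply vs)) ->
  forall v, Cl (S10 k) S v -> P v.
Proof.
move=> PS Pth v; elim=> [{}v /PS //|m f vs Cf _ Pvs].
elim: Cf vs Pvs => {m f} [vs|m i vs Pvs|m l g h _ IHg _ IHh vs Pvs].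
- exact: Pth.
- set u := mktuple _; have -> : u = vs i; last exact: Pvs.
  by apply: eq_from_tnth => j; rewrite tnth_mktuple ffunE tnth_mktuple.
- pose us i := [tuple h i [tuple tnth (vs i') j | i' < l] | j < n].
  set u := mktuple _.
  have -> : u = [tuple g [tuple tnth (us i) j | i < m] | j < n].
    apply: eq_from_tnth => j; rewrite !tnth_mktuple ffunE; congr (g _).
    by apply: eq_from_tnth => i; rewrite !tnth_mktuple.
  by apply: IHg => i; apply: IHh.
Qed.

Lemma Cl_th (k n : nat) (S : seq (n.-tuple bool)) (vs : 'I_k.+1 -> n.-tuple bool) :
  (forall i, Cl (S10 k) S (vs i)) -> Cl (S10 k) S (th_apply vs).
Proof. by move=> H; apply: Cl_op => //; apply: clone_gen. Qed.

(** A coordinate where the threshold is 1 is missed by at most one of the [k.+1] arguments. Hence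
    [k] such coordinates spoil at most [k] arguments, and an unspoiled one contains them all. *)
Lemma Cl_feasible (k n : nat) (S : seq (n.-tuple bool)) (v : n.-tuple bool) :
  0 < k -> Cl (S10 k) S v -> feasible k S v.
Proof.
move=> k0; move: v; apply: Cl_S10_ind => [v vS|vs Hvs].
  split=> [|t z vt vz|z vz]; last by exists v.
    by apply/kcoveredP => T TI _; exists v.
  by exists v => //; rewrite vt vz.
have miss t : tnth (th_apply vs) t -> #|[set i | ~~ tnth (vs i) t]| <= 1.
  by rewrite th_applyE.
split=> [|t z|z].
- apply/kcoveredP => T TI Tk.
  pose B := \bigcup_(t in T) [set i | ~~ tnth (vs i) t].
  have cB : #|B| <= #|T|.
    rewrite /B -[#|T|]sum1_card.
    apply: (big_ind2 (fun (X : {set 'I_k.+1}) x => #|X| <= x)) => [|X1 x1 X2 x2 H1 H2|t tT].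
    + by rewrite cards0.
    + by apply: leq_trans (leq_card_setU _ _) _; apply: leq_add.
    + by apply: miss; have := subsetP TI t tT; rewrite inE.
  have [i iB] : exists i, i \notin B.
    apply/existsP; rewrite -negb_forall; apply/negP => /forallP H.
    have : #|[set: 'I_k.+1]| <= #|B| by apply/subset_leq_card/subsetP => i _.
    by rewrite cardsT card_ord; lia.
  have [/kcoveredP H _ _] := Hvs i; apply: H => //.
  apply/subsetP => t tT; rewrite inE; apply: contraR iB => H.
  by apply/bigcupP; exists t => //; rewrite inE.
- move=> /miss ht; rewrite th_applyE -ltnNge => hz.
  (* At least two arguments vanish at [z] and at most one at [t]. *)
  have [i] : exists i, i \in [set i | ~~ tnth (vs i) z] :\: [set i | ~~ tnth (vs i) t].
    apply/set0Pn; apply: contraTneq hz => /eqP; rewrite setD_eq0 -leqNgt.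
    by move/subset_leq_card => /leq_trans; exact.
  rewrite !inE negbK => /andP[it iz].
  by have [_ H _] := Hvs i; apply: H.
- rewrite th_applyE -ltnNge => hz.
  have [i] : exists i, i \in [set i | ~~ tnth (vs i) z].
    by apply/card_gt0P; apply: leq_trans hz.
  by rewrite inE => iz; have [_ _ H] := Hvs i; apply: H.
Qed.

(* Baker-Pixley: [Th k k.+1] is a near-unanimity operation, so that a closed
   set is determined by its projections to [k] coordinates. *)
Lemma near_unanimity (k n : nat) (P : n.-tuple bool -> Prop) (v : n.-tuple bool) :
  1 < k ->
  (forall vs : 'I_k.+1 -> n.-tuple bool, (forall i, P (vs i)) -> P (th_apply vs)) ->
  (forall J : {set 'I_n}, #|J| <= k ->
     exists2 u, P u & forall j, j \in J -> tnth u j = tnth v j) ->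
  P v.
Proof.
move=> k1 Pth HJ.
(* Interpolation on larger and larger sets: dropping each of [k.+1] coordinates of [J] in turn gives
   [k.+1] interpolants, and at any coordinate of [J] at most one of them is wrong. *)
suff H m (J : {set 'I_n}) : #|J| <= m ->
    exists u, P u /\ forall j, j \in J -> tnth u j = tnth v j.
  have [|u [Pu Eu]] := H n setT; first by rewrite cardsT card_ord.
  by have <- : u = v by apply: eq_from_tnth => j; apply: Eu.
elim: m J => [|m IH] J Jm.
  have [|u Pu Eu] := HJ J; last by exists u.
  by apply: leq_trans Jm _.
have [Jk|kJ] := leqP #|J| k; first by have [u Pu Eu] := HJ J Jk; exists u.
pose js (i : 'I_k.+1) : 'I_n := enum_val (widen_ord kJ i).
have jsJ i : js i \in J by apply: enum_valP.
have js_inj : injective js by move=> i i' /enum_val_inj /(congr1 val) /= /val_inj.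
have [us Hus] : exists us : 'I_k.+1 -> n.-tuple bool, forall i,
    P (us i) /\ forall j, j \in J :\ js i -> tnth (us i) j = tnth v j.
  apply: (@fin_all_exists 'I_k.+1 (fun=> n.-tuple bool)
    (fun i u => P u /\ forall j, j \in J :\ js i -> tnth u j = tnth v j)) => i.
  by apply: IH; move: Jm; rewrite (cardsD1 (js i)) jsJ.
exists (th_apply us); split; first by apply: Pth => i; case: (Hus i).
move=> j jJ.
have bad : #|[set i | tnth (us i) j != tnth v j]| <= 1.
  rewrite leqNgt; apply/negP => /card_gt1P [i [i' []]].
  rewrite !inE => Hi Hi' /eqP[]; apply: js_inj.
  transitivity j; [symmetry |]; apply/eqP.
    by apply: contraR Hi => ne; have [_ ->] := Hus i; rewrite // !inE ne.
  by apply: contraR Hi' => ne; have [_ ->] := Hus i'; rewrite // !inE ne.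
(* One wrong argument is harmless on either side: a single 0 leaves [k] ones, and a single 1 is
   below the threshold because [1 < k]. *)
have [vj|vj] := boolP (tnth v j).
  rewrite th_applyE; apply: leq_trans bad; apply: subset_leq_card.
  by apply/subsetP => i; rewrite !inE vj eqb_id.
apply: negbTE; rewrite tnth_th_apply -ltnNge; apply: leq_ltn_trans _ k1.
apply: leq_trans bad; apply: subset_leq_card.
by apply/subsetP => i; rewrite !inE (negbTE vj) eqbF_neg negbK.
Qed.

(* [x /\ (y \/ z)] arises from [Th k k.+1] by identifying all but two
   arguments. *)
Lemma and_or_closed (k n : nat) (P : n.-tuple bool -> Prop) (x y z : n.-tuple bool) :
  2 < k ->
  (forall vs : 'I_k.+1 -> n.-tuple bool, (forall i, P (vs i)) -> P (th_apply vs)) ->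
  P x -> P y -> P z ->
  P [tuple tnth x j && (tnth y j || tnth z j) | j < n].
Proof.
move=> k2 Pth Px Py Pz.
(* [x] fills [k - 1] places, one short of the threshold, while the ones of [y] and [z] alone stay
   below it because [2 < k]. *)
pose vs (i : 'I_k.+1) := if i == ord0 then y else if i == ord_max then z else x.
suff <- : th_apply vs = [tuple tnth x j && (tnth y j || tnth z j) | j < n].
  by apply: Pth => i; rewrite /vs; case: ifP => // _; case: ifP.
have om : ord_max != ord0 :> 'I_k.+1 by rewrite -val_eqE /=; lia.
apply: eq_from_tnth => j; rewrite tnth_mktuple.
case xj: (tnth x j) => /=.
  rewrite th_applyE.
  case yj: (tnth y j) => /=.
    apply: leq_trans (_ : #|[set (@ord_max k)]| <= 1); last by rewrite cards1.
    apply/subset_leq_card/subsetP => i; rewrite !inE /vs.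
    by case: eqP => [->|_]; rewrite ?yj //; case: eqP; rewrite ?xj.
  case zj: (tnth z j) => /=.
    apply: leq_trans (_ : #|[set (@ord0 k)]| <= 1); last by rewrite cards1.
    apply/subset_leq_card/subsetP => i; rewrite !inE /vs.
    by case: (i == ord0) => //; case: (i == ord_max); rewrite ?xj ?zj.
  apply: negbTE; rewrite -ltnNge; apply/card_gt1P; exists ord0, ord_max.
  by split; rewrite ?inE /vs ?eqxx ?(negbTE om) ?yj ?zj // eq_sym.
apply: negbTE; rewrite tnth_th_apply -ltnNge.
apply: leq_ltn_trans (_ : #|[set @ord0 k; ord_max]| < k); last first.
  by rewrite cards2; case: eqP => _; lia.
apply/subset_leq_card/subsetP => i; rewrite !inE /vs.
by case: eqP => //= _; case: eqP => //= _; rewrite xj.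
Qed.

Lemma and_closed (k n : nat) (P : n.-tuple bool -> Prop) (x y : n.-tuple bool) :
  2 < k ->
  (forall vs : 'I_k.+1 -> n.-tuple bool, (forall i, P (vs i)) -> P (th_apply vs)) ->
  P x -> P y -> P [tuple tnth x j && tnth y j | j < n].
Proof.
move=> k2 Pth Px Py; have := and_or_closed k2 Pth Px Py Py.
set u := mktuple _; set u' := mktuple _; suff -> : u = u' by [].
by apply: eq_from_tnth => j; rewrite !tnth_mktuple orbb.
Qed.

(** By near-unanimity it suffices to match [v] on each [J] of at most [k] coordinates. For every
    zero [z] of [v], [sep] provides a closed vector that keeps the ones of [v] in [J] and vanishes
    at [z]; the conjunction over the zeros in [J] matches [v]. *)
Lemma feasible_Cl (k n : nat) (S : seq (n.-tuple bool)) (v : n.-tuple bool) :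
  2 < k -> feasible k S v -> Cl (S10 k) S v.
Proof.
move=> k2 [/kcoveredP Ha Hb Hc]; have Pth := @Cl_th k n S.
apply: (near_unanimity (ltnW k2) Pth) => J Jk.
have [s sS Ts] := Ha (J :&: ones v) (subsetIr _ _)
  (leq_trans (subset_leq_card (subsetIl _ _)) Jk).
have sC := Cl_base (S10 k) sS.
(* Disjunctions are available only below a closed vector; here [s] is one that contains all the ones
   to be kept, so they are collected one at a time by [s /\ (s1 \/ u)]. *)
have sep z : ~~ tnth v z -> exists u, [/\ Cl (S10 k) S u,
    forall t, t \in J -> tnth v t -> tnth u t & ~~ tnth u z].
  move=> vz; have [s0 s0S s0z] := Hc z vz.
  have : {subset enum (J :&: ones v) <= J :&: ones v} by move=> x; rewrite mem_enum.
  suff H (l : seq 'I_n) : {subset l <= J :&: ones v} -> exists u, [/\ Cl (S10 k) S u,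
      forall t, t \in l -> tnth u t & ~~ tnth u z].
    move=> /H [u [Cu Hu uz]]; exists u; split=> // t tJ vt.
    by apply: Hu; rewrite mem_enum !inE tJ.
  elim: l => [|t l IHl] tl.
    by exists s0; split=> //; apply: Cl_base.
  have [x xl|u [Cu Hu uz]] := IHl; first by apply: tl; rewrite inE xl orbT.
  have tv : t \in J :&: ones v by apply: tl; rewrite mem_head.
  have [s1 s1S /andP[s1t s1z]] : exists2 s1, s1 \in S & tnth s1 t && ~~ tnth s1 z.
    by apply: Hb => //; move: tv; rewrite !inE => /andP[].
  exists [tuple tnth s j && (tnth s1 j || tnth u j) | j < n]; split.
  - exact: and_or_closed k2 Pth sC (Cl_base (S10 k) s1S) Cu.
  - move=> x xl; rewrite tnth_mktuple.
    have := subsetP Ts x (tl x xl); rewrite inE => -> /=.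
    by move: xl; rewrite inE => /predU1P [->|/Hu ->]; rewrite ?s1t ?orbT.
  - by rewrite tnth_mktuple negb_and negb_or s1z uz orbT.
have : {subset enum (J :\: ones v) <= J :\: ones v} by move=> x; rewrite mem_enum.
suff H (l : seq 'I_n) : {subset l <= J :\: ones v} -> exists u, [/\ Cl (S10 k) S u,
    forall t, t \in J -> tnth v t -> tnth u t & forall z, z \in l -> ~~ tnth u z].
  move=> /H [u [Cu Hu uz]]; exists u => // j jJ.
  have [vj|vj] := boolP (tnth v j); first by rewrite Hu.
  by apply: negbTE; apply: uz; rewrite mem_enum !inE vj.
elim: l => [|z l IHl] zl.
  exists s; split=> // t tJ vt; have := subsetP Ts t.
  by rewrite !inE tJ; apply.
have [x xl|u [Cu Hu uz]] := IHl; first by apply: zl; rewrite inE xl orbT.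
have zv : ~~ tnth v z by have := zl z; rewrite mem_head !inE => /(_ isT) /andP[].
have [u' [Cu' Hu' uz']] := sep z zv.
exists [tuple tnth u j && tnth u' j | j < n]; split.
- exact: and_closed k2 Pth Cu Cu'.
- by move=> t tJ vt; rewrite tnth_mktuple Hu // Hu'.
- move=> x; rewrite inE tnth_mktuple negb_and => /predU1P [->|/uz ->] //.
  by rewrite uz' orbT.
Qed.

Lemma ClP (k n : nat) (S : seq (n.-tuple bool)) (v : n.-tuple bool) :
  2 < k -> Cl (S10 k) S v <-> feasible k S v.
Proof.
by move=> k2; split; [apply: Cl_feasible; lia | apply: feasible_Cl].
Qed.

(** * Maximal elements of the closure *)

Lemma onesK (n : nat) : cancel (@ones n) (@charvec n).
Proof. by move=> v; apply: eq_from_tnth => i; rewrite tnth_mktuple inE. Qed.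

Lemma charvecK (n : nat) : cancel (@charvec n) (@ones n).
Proof. by move=> I; apply/setP => i; rewrite inE tnth_mktuple. Qed.

Lemma bvleE (n : nat) (v w : n.-tuple bool) : bvle v w <-> ones v \subset ones w.
Proof.
split=> [H|/subsetP H]; first by apply/subsetP => i; rewrite !inE; apply: H.
by move=> i vi; have := H i; rewrite !inE; apply.
Qed.

Lemma ones_nseq_false (n : nat) : ones [tuple of nseq n false] = set0.
Proof. by apply/setP => i; rewrite !inE (tnth_nth false) nth_nseq if_same. Qed.

Lemma ones_nseq_true (n : nat) : ones [tuple of nseq n true] = setT.
Proof. by apply/setP => i; rewrite !inE (tnth_nth false) nth_nseq ltn_ord. Qed.

Lemma ClNontrivialP (k n : nat) (S : seq (n.-tuple bool)) (v : n.-tuple bool) :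
  2 < k ->
  ClNontrivial (S10 k) S v <->
  [/\ feasible k S v, ones v != set0 & ones v != setT].
Proof.
move=> k2; rewrite -ones_nseq_false -ones_nseq_true !(inj_eq (can_inj (@onesK n))).
by split=> -[/(ClP _ _ k2) Cv /eqP v0 /eqP v1].
Qed.

Lemma maxset_hereditaryP (T : finType) (P : pred {set T}) (I : {set T}) :
  (forall A B : {set T}, A \subset B -> P B -> P A) ->
  maxset P I <-> P I /\ forall i, i \notin I -> ~~ P (i |: I).
Proof.
move=> Psub; split.
  move/maxsetP => [PI H]; split=> // i iI; apply: contra iI => /H.
  by move/(_ (subsetU1 _ _)) <-; rewrite setU11.
move=> [PI H]; apply/maxsetP; split=> // B PB IB.
apply/eqP; rewrite eqEsubset IB andbT; apply/subsetP => i iB.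
apply: contraLR PB => /H; apply: contra; apply: Psub.
by rewrite subUset sub1set iB.
Qed.

(* A maximal [kcovered] set [I] satisfies the implications of [S]: for
   [z \notin I], an uncovered subset of [z |: I] contains [z], and replacing
   [z] by some [t] in [I] yields a covered set. *)
Lemma maxset_kcovered_feasible (k n : nat) (S : seq (n.-tuple bool)) (v : n.-tuple bool) :
  maxset (kcovered k S) (ones v) -> feasible k S v.
Proof.
case/maxset_hereditaryP; first exact: kcovered_sub.
move=> cI Hmax.
have unc z : ~~ tnth v z -> exists T : {set 'I_n},
    [/\ T :\ z \subset ones v, z \in T, #|T| <= k
      & forall s, s \in S -> ~~ (T \subset ones s)].
  move=> vz; have zI : z \notin ones v by rewrite inE.
  have /forallPn [T] := Hmax z zI.
  rewrite !negb_imply => /and3P [TI Tk nT]; exists T; split=> //.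
  - by rewrite subDset.
  - apply: contraR nT => zT; move/kcoveredP: cI => cI; apply/hasP; apply: cI => //.
    apply/subsetP => x xT; have := subsetP TI x xT; rewrite in_setU1 => /predU1P [Ex|//].
    by rewrite Ex (negbTE zT) in xT.
  - by move=> s sS; apply: contra nT => Ts; apply/hasP; exists s.
split=> // [t z vt vz|z vz]; have [T [TI zT Tk nT]] := unc z vz.
  have [||s sS] := kcoveredP _ _ _ cI (t |: T :\ z).
  - by rewrite subUset sub1set inE vt.
  - by move: Tk; rewrite cardsU1 (cardsD1 z T) zT; case: (t \notin _) => //; exact: ltnW.
  rewrite subUset sub1set inE => /andP[st Ts]; exists s => //; rewrite st /=.
  by apply: contra (nT s sS) => sz; rewrite -(setD1K zT) subUset Ts sub1set inE sz.
have [|s sS Ts] := kcoveredP _ _ _ cI (T :\ z) TI.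
  by move: Tk; rewrite (cardsD1 z T) zT; exact: ltnW.
exists s => //.
by apply: contra (nT s sS) => sz; rewrite -(setD1K zT) subUset Ts sub1set inE sz.
Qed.

(** A maximal [kcovered] set is itself feasible, and every closed vector lies below one. It differs
    from the full set by hypothesis, but it may be empty, hence the remaining condition. *)
Lemma ClMax_uncovered (k n : nat) (S : seq (n.-tuple bool)) (v : n.-tuple bool) :
  2 < k -> ~~ kcovered k S setT ->
  ClMax (S10 k) S v <-> maxset (kcovered k S) (ones v) /\ ones v != set0.
Proof.
move=> k2 nT; split.
  move=> [/(ClNontrivialP _ _ k2) [[cv _ _] v0 v1] vmax]; split=> //.
  have [J Jmax vJ] := maxset_exists cv.
  rewrite -[J]charvecK in Jmax vJ *.
  suff -> : v = charvec J by [].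
  symmetry; apply: vmax; last exact/bvleE.
  apply/(ClNontrivialP _ _ k2); split; first exact: maxset_kcovered_feasible.
    by apply: contraNneq v0 => J0; rewrite J0 subset0 in vJ.
  by apply: contraNneq nT => <-; apply: maxsetp Jmax.
move=> [vmax v0]; split.
  apply/(ClNontrivialP _ _ k2); split=> //; first exact: maxset_kcovered_feasible.
  by apply: contraNneq nT => <-; apply: maxsetp vmax.
move=> w /(ClNontrivialP _ _ k2) [[cw _ _] _ _] /bvleE vw.
by apply: (can_inj (@onesK n)); have /maxsetP [_] := vmax; apply.
Qed.

Definition separates (n : nat) (S : seq (n.-tuple bool)) (i j : 'I_n) : bool :=
  has (fun s => ~~ tnth s i && tnth s j) S.

(* The union of the vectors of [S] that vanish at [i]. *)
Definition avoiding (n : nat) (S : seq (n.-tuple bool)) (i : 'I_n) : n.-tuple bool :=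
  [tuple separates S i j | j < n].

(* [i] is the least index producing a given maximal nonzero [avoiding S i]. *)
Definition selected (n : nat) (S : seq (n.-tuple bool)) (i : 'I_n) : bool :=
  [exists j, separates S i j] &&
  [forall j : 'I_n, separates S i j || ((i <= j) && ~~ separates S j i)].

Lemma separates_irr (n : nat) (S : seq (n.-tuple bool)) (i : 'I_n) :
  ~~ separates S i i.
Proof. by apply/hasPn => s _; case: (tnth s i). Qed.

(** Equal unions make [separates S i j] agree with [separates S j j], which is false; the minimality
    clause then gives [i <= j], and symmetrically. *)
Lemma selected_inj (n : nat) (S : seq (n.-tuple bool)) :
  {in selected S &, injective (avoiding S)}.
Proof.
have H i j : selected S i -> avoiding S i = avoiding S j -> i <= j.
  move=> /andP[_ /forallP/(_ j)] + E.
  have -> : separates S i j = separates S j j.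
    by have := congr1 (fun v => tnth v j) E; rewrite !tnth_mktuple.
  by rewrite (negbTE (separates_irr S j)) => /andP[].
move=> i j Hi Hj E; apply: val_inj; apply/eqP; rewrite eqn_leq.
by rewrite (H i j) // (H j i).
Qed.

Lemma avoiding_feasible (k n : nat) (S : seq (n.-tuple bool)) (i : 'I_n) (s0 : n.-tuple bool) :
  kcovered k S setT -> s0 \in S -> ~~ tnth s0 i -> feasible k S (avoiding S i).
Proof.
move=> cT s0S s0i; split=> [|t z|z]; first by apply: kcovered_sub cT.
- rewrite !tnth_mktuple => /hasP [s sS /andP[si st]] /hasPn /(_ s sS).
  by rewrite si /= => sz; exists s; rewrite ?st.
- by rewrite tnth_mktuple => /hasPn /(_ s0 s0S); rewrite s0i /= => sz; exists s0.
Qed.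

(* If every [k]-subset is covered, only the implications and the constant
   coordinates constrain the closure, and its maximal proper elements are
   maximal among those avoiding some coordinate. *)
Lemma ClMax_covered (k n : nat) (S : seq (n.-tuple bool)) (v : n.-tuple bool) :
  2 < k -> kcovered k S setT ->
  ClMax (S10 k) S v <-> exists2 i, selected S i & v = avoiding S i.
Proof.
move=> k2 cT; split.
  move=> [/(ClNontrivialP _ _ k2) [[_ Hb Hc] v0 v1] vmax].
  (* [v] lies below the union of the vectors missing [z], which is closed and proper, so maximality
     forces equality for every zero of [v]; the least zero is then the selected index. *)
  have wv z : ~~ tnth v z -> avoiding S z = v.
    move=> vz; have [s0 s0S s0z] := Hc z vz.
    have vw : ones v \subset ones (avoiding S z).
      apply/subsetP => t; rewrite !inE tnth_mktuple => vt; apply/hasP.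
      by have [s sS /andP[st sz]] := Hb t z vt vz; exists s; rewrite ?st ?sz.
    apply: vmax; last exact/bvleE.
    apply/(ClNontrivialP _ _ k2); split; first exact: avoiding_feasible cT s0S s0z.
      by apply: contraNneq v0 => J0; rewrite J0 subset0 in vw.
    apply/negP => /eqP /setP /(_ z); rewrite !inE tnth_mktuple.
    by rewrite (negbTE (separates_irr S z)).
  have [z0 z0v] : exists z, ~~ tnth v z.
    apply/existsP; rewrite -negb_forall; apply: contra v1 => /forallP H.
    by apply/eqP/setP => i; rewrite !inE H.
  have [i vi imin] := @arg_minnP _ z0 (fun z => ~~ tnth v z) val z0v.
  exists i; last by rewrite wv.
  apply/andP; split.
    have /set0Pn [j] := v0; rewrite inE -{1}(wv i vi) tnth_mktuple => ij.
    by apply/existsP; exists j.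
  apply/forallP => j; have [//|/= nij] := boolP (separates S i j).
  have vj : ~~ tnth v j by rewrite -(wv i vi) tnth_mktuple.
  rewrite imin //=.
  by move: vi; rewrite -{1}(wv j vj) tnth_mktuple.
move=> [i /andP[/existsP [j0 ij0] /forallP Hi] ->].
have /hasP [s0 s0S /andP[s0i _]] := ij0.
split.
  apply/(ClNontrivialP _ _ k2); split; first exact: avoiding_feasible cT s0S s0i.
    by apply/set0Pn; exists j0; rewrite inE tnth_mktuple.
  apply/negP => /eqP /setP /(_ i); rewrite !inE tnth_mktuple.
  by rewrite (negbTE (separates_irr S i)).
move=> w /(ClNontrivialP _ _ k2) [[_ Hb _] _ w1] /bvleE sub.
apply: (can_inj (@onesK n)); apply/eqP; rewrite eqEsubset sub andbT.
(* A zero [z] of [w] is also one of the smaller [avoiding S i]. By selection, vectors of [S] missing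
   [z] miss [i], so the implications satisfied by [w] put its ones into [avoiding S i]. *)
have [z wz] : exists z, ~~ tnth w z.
  apply/existsP; rewrite -negb_forall; apply: contra w1 => /forallP H.
  by apply/eqP/setP => x; rewrite !inE H.
have niz : ~~ separates S i z.
  by apply: contra wz => iz; have := subsetP sub z; rewrite !inE tnth_mktuple; apply.
have := Hi z; rewrite (negbTE niz) /= => /andP[_ nzi].
apply/subsetP => t; rewrite !inE tnth_mktuple => wt.
have [s sS /andP[st sz]] := Hb t z wt wz.
apply/hasP; exists s => //; rewrite st andbT.
by apply: contra nzi => si; apply/hasP; exists s; rewrite ?sz.
Qed.

(** * Loop programs *)

Lemma polytime_of_cmd (A B : enum_problem) (f : inst A -> inst B) (c : cmd) :
  (forall x, outputs (eval (size (enc x)) (fun a => nth false (enc x) a) (fun=> 0) c)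
     = [:: enc (f x)]) ->
  polytime f.
Proof.
move=> H; have [b Hb] := compile_poly c; exists (compile c), b => x.
by have [t [h o ck _]] := Hb (enc x); exists t; split; rewrite // o H.
Qed.

(** A bound on the total time bounds every gap between outputs. *)
Lemma polydelay_of_cmd (A : enum_problem) (c : cmd) :
  (forall x : inst A,
     let o := outputs (eval (size (enc x)) (fun a => nth false (enc x) a) (fun=> 0) c) in
     uniq o /\ forall y, y \in o <-> solution x y) ->
  polydelay A.
Proof.
move=> H; have [b Hb] := compile_poly c; exists (compile c), b => x.
have [t [h o ck st]] := Hb (enc x); exists t.
have [u s] := H x; split; rewrite ?o //.
move: (polybound _ _) (unzip1 _) ck st => D l ck st.
have : all (fun s => s <= D) (rcons l (clock (run (compile c) (enc x) t))).
  by rewrite all_rcons ck.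
elim: (rcons _ _) {1}0 => //= a l' IH a0 /andP[aD l'D].
by rewrite IH // andbT (leq_trans aD) ?leq_addl.
Qed.

Definition events (ws : seq word) : seq (option bool) :=
  flatten [seq rcons (map Some w) None | w <- ws].

Lemma outputs_events (ws : seq word) : outputs (events ws) = ws.
Proof.
rewrite /outputs; suff H l : foldl record_event ([::], l) (events ws) = ([::], l ++ ws).
  by rewrite H.
elim: ws l => [|w ws IH] l; first by rewrite cats0.
rewrite /events /= foldl_cat -/(events ws) -cats1 foldl_cat.
have F b : foldl record_event (b, l) (map Some w) = (b ++ w, l).
  by elim: w b => [|x w IHw] b /=; rewrite ?cats0 // IHw cat_rcons.
by rewrite F /= IH cat_rcons.
Qed.

Lemma events1 (w : word) : events [:: w] = map Some w ++ [:: None].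
Proof. by rewrite /events /= cats0 cats1. Qed.

Definition truth (N : nat) (M env : nat -> nat) (e : expr) : bool :=
  den N M env e != 0.

Definition ENot (a : expr) : expr := ESub (ECst 1) a.
Definition ELt (a b : expr) : expr := ESub b a.
Definition EEq (a b : expr) : expr := ENot (EAdd (ESub a b) (ESub b a)).

Lemma truth_not N M env a : truth N M env (ENot a) = ~~ truth N M env a.
Proof. by rewrite /truth /=; lia. Qed.

Lemma truth_or N M env a b :
  truth N M env (EAdd a b) = truth N M env a || truth N M env b.
Proof. by rewrite /truth /=; lia. Qed.

Lemma truth_and N M env a b :
  truth N M env (EIf a b) = truth N M env a && truth N M env b.
Proof. by rewrite /truth /=; case: (den N M env a == 0). Qed.

Lemma truth_lt N M env a b :
  truth N M env (ELt a b) = (den N M env a < den N M env b).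
Proof. by rewrite /truth /=; lia. Qed.

Lemma truth_eq N M env a b :
  truth N M env (EEq a b) = (den N M env a == den N M env b).
Proof. by rewrite /truth /=; lia. Qed.

Lemma truth_sum N M env x a :
  truth N M env (ESum x a) =
  has (fun j => truth N M [eta env with x |-> j] a) (iota 0 N).
Proof.
rewrite /truth /= /index_iota subn0; elim: (iota 0 N) => [|j l IH] /=.
  by rewrite big_nil.
by rewrite big_cons addn_eq0 negb_and IH.
Qed.

Lemma has_iota_ord (N n : nat) (p : pred nat) :
  n <= N -> has (fun j => (j < n) && p j) (iota 0 N) = [exists i : 'I_n, p i].
Proof.
move=> nN; apply/hasP/existsP => [[j _ /andP[jn pj]]|[i pi]].
  by exists (Ordinal jn).
by exists (val i); rewrite ?ltn_ord // mem_iota /=; apply: leq_trans nN.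
Qed.

(* The number of nonzero cells from address [b] up to the first zero. *)
Definition EOnes (b : expr) : expr :=
  ESum 0 (ENot (ESum 1 (EIf (ENot (ELt (EVar 0) (EVar 1)))
                            (ENot (EMem (EAdd b (EVar 1))))))).

(** An index [j] is counted when no zero cell has offset at most [j]. As [b] is evaluated under two
    binders, its value must not depend on the environment. *)
Lemma den_ones (N : nat) (M env : nat -> nat) (b : expr) (B n : nat) :
  (forall env, den N M env b = B) -> n < N ->
  (forall i, i < n -> M (B + i) != 0) -> M (B + n) = 0 ->
  den N M env (EOnes b) = n.
Proof.
move=> HB nN Mi Mn.
have E j : j < N -> den N M [eta env with 0 |-> j]
    (ENot (ESum 1 (EIf (ENot (ELt (EVar 0) (EVar 1)))
       (ENot (EMem (EAdd b (EVar 1))))))) = (j < n).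
  move=> jN.
  have H : forall e, den N M [eta env with 0 |-> j] (ENot e) =
      ~~ truth N M [eta env with 0 |-> j] e :> nat.
    by move=> e; rewrite /truth /=; lia.
  rewrite H truth_sum; congr nat_of_bool.
  apply/hasPn/idP => [Hj|jn i _].
    rewrite ltnNge; apply/negP => nj.
    have := Hj n; rewrite mem_iota /= => /(_ nN).
    by rewrite truth_and !truth_not truth_lt /= /truth /= HB Mn -leqNgt nj.
  rewrite truth_and !truth_not truth_lt /= /truth /= HB -leqNgt.
  by case: leqP => //= ij; rewrite negbK Mi //; lia.
rewrite /EOnes; cbn [den].
rewrite (eq_big_nat _ _ (F2 := fun j => nat_of_bool (j < n))); last first.
  by move=> j /= jN; exact: E.
rewrite (@big_cat_nat _ _ _ n) //=; last exact: ltnW.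
rewrite big_nat_cond (eq_bigr (fun=> 1)); last by move=> i /andP[/andP[_ ->]].
rewrite -big_nat_cond sum_nat_const_nat subn0 muln1.
rewrite [X in _ + X]big1_seq ?addn0 // => i /=.
by rewrite mem_index_iota => /andP[ni _]; rewrite ltnNge ni.
Qed.

(** Repeated addition, correct as long as the first factor is at most the loop bound [N]. *)
Definition EMul (a b : expr) : expr := ESum 2 (EIf (ELt (EVar 2) a) b).

Lemma den_mul (N : nat) (M env : nat -> nat) (a b : expr) (va vb : nat) :
  (forall j, den N M [eta env with 2 |-> j] a = va) ->
  (forall env, den N M env b = vb) -> va <= N ->
  den N M env (EMul a b) = va * vb.
Proof.
move=> Ha Hb vaN; rewrite /EMul; cbn [den].
rewrite (eq_bigr (fun j => if j < va then vb else 0)); last first.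
  move=> j _; rewrite Hb; cbn [den ELt]; rewrite Ha /= subn_eq0.
  by rewrite leqNgt; case: ltnP.
rewrite -big_mkcond /=; rewrite (@big_cat_nat _ _ _ va) //=.
rewrite big_nat_cond (eq_bigl (fun i => (0 <= i < va))); last first.
  by move=> i /=; case: ltnP.
rewrite -big_nat sum_nat_const_nat subn0.
rewrite [X in _ + X]big1_seq ?addn0 // => i /=.
by rewrite mem_index_iota => /andP[H /andP[H' _]]; lia.
Qed.

(** * Reading a list of Boolean vectors *)

(* [eB] denotes the address at which the encoding of [S] is stored and [eL]
   its length. *)
Definition stores (N : nat) (M : nat -> nat) (eB eL : expr) (S : bvlist) : Prop :=
  [/\ forall env, den N M env eL = size (enc_bvlist S),
      size (enc_bvlist S) <= N
    & exists2 B, forall env, den N M env eB = B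
        & forall a, a < size (enc_bvlist S) ->
            M (B + a) = nth false (enc_bvlist S) a].

Lemma size_enc_bvlist (S : bvlist) :
  size (enc_bvlist S) = (tag S).+1 * (size (tagged S)).+1 + 1.
Proof.
case: S => n s; rewrite /enc_bvlist /= size_cat size_nseq /= size_cat /=.
suff -> : size (flatten [seq true :: tval v | v <- s]) = n.+1 * size s by nia.
elim: s => [|v s IH] /=; first by rewrite muln0.
by rewrite size_cat IH size_tuple mulnS addSn.
Qed.

(** The header and each record, a marker followed by the bits, occupy [(tag S).+1] cells; the extra
    1 skips the marker. *)
Lemma nth_enc_bvlist (S : bvlist) (r : nat) (v0 : (tag S).-tuple bool) (i : 'I_(tag S)) :
  r < size (tagged S) ->
  nth false (enc_bvlist S) (r.+1 * (tag S).+1 + 1 + i) = tnth (nth v0 (tagged S) r) i.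
Proof.
case: S v0 i => n s /= v0 i rs; rewrite /enc_bvlist /= nth_cat size_nseq.
rewrite ltnNge (_ : n <= _) /=; last by rewrite mulSn; lia.
rewrite (_ : _ - n = (r * n.+1 + 1 + i).+1) /=; last by rewrite mulSn; lia.
elim: s r rs => [|v s IH] [|r] //= rs.
  by rewrite -catA nth_cat size_tuple ltn_ord -tnth_nth.
rewrite plusE -catA nth_cat size_tuple.
rewrite ltnNge (_ : n <= _) /=; last by lia.
by rewrite (_ : _ - n = r * n.+1 + 1 + i) ?IH //; lia.
Qed.

Definition EDim (eB : expr) : expr := EOnes eB.

(** Fixed names prevent capture: 0 and 1 are bound in [EOnes], 2 in [EMul], 3 is the vector index,
    4, 5, 7 and 8 are coordinates, 6 is bound in [ESize], and the entries of a tuple start at 10. *)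
Definition EPos (eB : expr) (r : nat) : expr :=
  EMul (EAdd (EVar r) (ECst 1)) (EAdd (EDim eB) (ECst 1)).

(* [r] and [i] are the names of the variables that hold the indices. *)
Definition EBit (eB : expr) (r i : nat) : expr :=
  EMem (EAdd eB (EAdd (EAdd (EPos eB r) (ECst 1)) (EVar i))).

(** The number of vectors is never computed: record [r] exists exactly when the address just after
    it still lies inside the encoding, thanks to the closing [false]. *)
Definition EHas (eB eL a : expr) : expr :=
  ESum 3 (EIf (ELt (EAdd (EPos eB 3) (EAdd (EDim eB) (ECst 1))) eL) a).

Definition EEx (eB : expr) (x : nat) (a : expr) : expr :=
  ESum x (EIf (ELt (EVar x) (EDim eB)) a).

Lemma den_dim (N : nat) (M env : nat -> nat) (eB eL : expr) (S : bvlist) :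
  stores N M eB eL S -> den N M env (EDim eB) = tag S.
Proof.
move=> [_ leN [B HB HM]]; have sz := size_enc_bvlist S.
apply: (den_ones _ HB) => [|i iS|]; first by nia.
  rewrite HM; last by nia.
  by case: S iS {leN HB HM sz} => n s /= iS; rewrite nth_cat size_nseq iS nth_nseq iS.
rewrite HM; last by nia.
by case: S {leN HB HM sz} => n s /=; rewrite nth_cat size_nseq ltnn subnn.
Qed.

Lemma dim_le (N : nat) (M : nat -> nat) (eB eL : expr) (S : bvlist) :
  stores N M eB eL S -> tag S < N.
Proof. by move=> [_ leN _]; have := size_enc_bvlist S; nia. Qed.

Lemma den_pos (N : nat) (M env : nat -> nat) (eB eL : expr) (S : bvlist) (r : nat) :
  stores N M eB eL S -> env r < N -> r != 2 ->
  den N M env (EPos eB r) = (env r).+1 * (tag S).+1.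
Proof.
move=> HS rN r2; apply: den_mul => [j|env'|//].
  by rewrite /= (negbTE r2) addn1.
by cbn [den]; rewrite (den_dim _ HS) addn1.
Qed.

Lemma truth_bit (N : nat) (M env : nat -> nat) (eB eL : expr) (S : bvlist)
    (r : nat) (v0 : (tag S).-tuple bool) (x : nat) (i : 'I_(tag S)) :
  stores N M eB eL S -> env r < size (tagged S) -> r != 2 -> env x = i ->
  truth N M env (EBit eB r x) = tnth (nth v0 (tagged S) (env r)) i.
Proof.
move=> HS rS r2 xi; have sz := size_enc_bvlist S; have [_ leN [B HB HM]] := HS.
have rN : env r < N by nia.
rewrite /truth /EBit; cbn [den].
have i_lt := ltn_ord i.
rewrite (den_pos HS rN r2) HB xi HM ?(nth_enc_bvlist v0) ?eqb0 ?negbK //.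
by nia.
Qed.

Lemma truth_has (N : nat) (M env : nat -> nat) (eB eL a : expr) (S : bvlist)
    (v0 : (tag S).-tuple bool) (p : pred ((tag S).-tuple bool)) :
  stores N M eB eL S ->
  (forall r, r < size (tagged S) ->
     truth N M [eta env with 3 |-> r] a = p (nth v0 (tagged S) r)) ->
  truth N M env (EHas eB eL a) = has p (tagged S).
Proof.
move=> HS Ha; have sz := size_enc_bvlist S; have [HL leN _] := HS.
rewrite truth_sum.
have E r : r < N -> truth N M [eta env with 3 |-> r]
    (EIf (ELt (EAdd (EPos eB 3) (EAdd (EDim eB) (ECst 1))) eL) a) =
    (r < size (tagged S)) && p (nth v0 (tagged S) r).
  move=> rN; rewrite truth_and truth_lt HL sz; cbn [den].
  rewrite (den_pos HS) // (den_dim _ HS) /=.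
  have -> : (r.+1 * (tag S).+1 + (tag S + 1) < (tag S).+1 * (size (tagged S)).+1 + 1) =
            (r < size (tagged S)) by nia.
  by case: ltnP => //= rS; rewrite Ha.
apply/hasP/(has_nthP v0) => [[r]|[r rS pr]].
  by rewrite mem_iota => rN; rewrite E // => /andP[rS pr]; exists r.
have rN : r < N by nia.
by exists r; rewrite ?mem_iota // E // rS.
Qed.

Lemma truth_ex (N : nat) (M env : nat -> nat) (eB eL a : expr) (S : bvlist)
    (x : nat) (p : pred nat) :
  stores N M eB eL S ->
  (forall i, i < tag S -> truth N M [eta env with x |-> i] a = p i) ->
  truth N M env (EEx eB x a) = [exists i : 'I_(tag S), p i].
Proof.
move=> HS Ha; rewrite truth_sum -(has_iota_ord _ (ltnW (dim_le HS))).
apply: eq_has => i; rewrite truth_and truth_lt (den_dim _ HS).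
have -> : den N M [eta env with x |-> i] (EVar x) = i by exact: eta_eq.
by case: ltnP => //= iS; rewrite Ha.
Qed.

Definition CBits (eB : expr) (a : expr) : cmd :=
  CFor 5 (CIf (ELt (EVar 5) (EDim eB)) (CWrite a)).

Lemma flatten_iota_lt (T : Type) (N n : nat) (g : nat -> seq T) :
  n <= N ->
  flatten [seq if j < n then g j else [::] | j <- iota 0 N] =
  flatten [seq g j | j <- iota 0 n].
Proof.
move=> nN; rewrite -{1}(subnKC nN) iotaD map_cat flatten_cat add0n.
have -> : flatten [seq if j < n then g j else [::] | j <- iota n (N - n)] = [::].
  have : all (leq n) (iota n (N - n)) by apply/allP => j; rewrite mem_iota => /andP[].
  by elim: (iota _ _) => //= j l IH /andP[nj /IH ->]; rewrite ltnNge nj.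
rewrite cats0; congr flatten; apply/eq_in_map => j.
by rewrite mem_iota /= => ->.
Qed.

Lemma eval_bits (N : nat) (M env : nat -> nat) (eB eL a : expr) (S : bvlist)
    (p : nat -> bool) :
  stores N M eB eL S ->
  (forall i, i < tag S -> truth N M [eta env with 5 |-> i] a = p i) ->
  eval N M env (CBits eB a) = map Some (mkseq p (tag S)).
Proof.
move=> HS Ha; rewrite /CBits; cbn [eval].
rewrite /mkseq -map_comp.
transitivity (flatten [seq (if j < tag S then [:: Some (p j)] else [::]) | j <- iota 0 N]).
  congr flatten; apply: eq_map => j.
  have := truth_lt N M [eta env with 5 |-> j] (EVar 5) (EDim eB).
  have -> : den N M [eta env with 5 |-> j] (EVar 5) = j by [].
  rewrite (den_dim _ HS) /truth => /negbRL ->.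
  case: ltnP => //= jS; congr [:: Some _]; exact: Ha.
rewrite (flatten_iota_lt _ (ltnW (dim_le HS))).
by rewrite -[map _ _ in RHS]flatten_seq1 -map_comp.
Qed.

Fixpoint CConst (b : bool) (m : nat) : cmd :=
  if m is m'.+1 then CSeq (CWrite (ECst b)) (CConst b m') else CSkip.

Lemma eval_const (N : nat) (M env : nat -> nat) (b : bool) (m : nat) :
  eval N M env (CConst b m) = map Some (nseq m b).
Proof. by elim: m => //= m ->; case: b. Qed.

(** * Enumerating the subsets of bounded size *)

(** The order is that of [CLoops], whose outermost loop fixes the last entry. *)
Fixpoint words (N k : nat) : seq (seq nat) :=
  if k is k'.+1 then [seq rcons t j | j <- iota 0 N, t <- words N k']
  else [:: [::]].

Lemma mem_words (N k : nat) (t : seq nat) :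
  (t \in words N k) = (size t == k) && all (fun j => j < N) t.
Proof.
elim: k t => [|k IH] t /=; first by rewrite inE; case: t.
apply/allpairsP/andP => [[[j u] /= [jN uN ->]]|].
  move: uN; rewrite IH size_rcons eqSS all_rcons => /andP[-> ->].
  by move: jN; rewrite mem_iota add0n /= => ->.
case/lastP: t => [[] //|t j]; rewrite size_rcons eqSS all_rcons => -[st /andP[jN tN]].
by exists (j, t); rewrite IH st tN mem_iota.
Qed.

Fixpoint CLoops (k : nat) (c : cmd) : cmd :=
  if k is k'.+1 then CFor (10 + k') (CLoops k' c) else c.

(** The condition on variables from [10 + k] on lets the induction remember the values chosen by the
    outer loops. *)
Lemma eval_loops (N : nat) (M env : nat -> nat) (k : nat) (c : cmd)
    (g : seq nat -> seq (option bool)) :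
  (forall env', (forall l, 10 + k <= l -> env' l = env l) ->
     eval N M env' c = g [seq env' (10 + l) | l <- iota 0 k]) ->
  eval N M env (CLoops k c) = flatten [seq g t | t <- words N k].
Proof.
elim: k env g => [|k IH] env g Hg; first by rewrite /= cats0 (Hg env).
rewrite /= map_allpairs; elim: (iota 0 N) => //= j l IHl.
rewrite flatten_cat -IHl; congr (_ ++ _).
rewrite (IH _ (fun t => g (rcons t j))) => [|env' Henv'].
  by [].
rewrite Hg => [|x kx].
  by rewrite -(addn1 k) iotaD map_cat cats1 add0n Henv' //= eqxx.
by rewrite Henv' /= ?gtn_eqF //; lia.
Qed.

Definition EIn (k x : nat) : expr :=
  foldr (fun l e => EAdd (EEq (EVar x) (EVar (10 + l))) e) (ECst 0) (iota 0 k).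

Lemma truth_in (N : nat) (M env : nat -> nat) (k x : nat) :
  truth N M env (EIn k x) = (env x \in [seq env (10 + l) | l <- iota 0 k]).
Proof.
rewrite /EIn; elim: (iota 0 k) => //= l s IH.
by rewrite truth_or truth_eq inE IH.
Qed.

Definition tset (n : nat) (t : seq nat) : {set 'I_n} := [set i | val i \in t].

Lemma card_tset (n : nat) (t : seq nat) : #|tset n t| <= size t.
Proof.
rewrite cardE -(size_map val); apply: uniq_leq_size => [|j].
  by rewrite map_inj_uniq ?enum_uniq //; exact: val_inj.
by case/mapP => i; rewrite mem_enum inE => it ->.
Qed.

(* Indices that are at least [n] are ignored, so [words] also yields the sets
   with fewer than [k] elements. *)
Lemma tset_words (N n k : nat) (T : {set 'I_n}) :
  n < N -> #|T| <= k -> exists2 t, t \in words N k & tset n t = T.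
Proof.
move=> nN Tk; exists (map val (enum T) ++ nseq (k - #|T|) n).
  rewrite mem_words size_cat size_map -cardE size_nseq subnKC // eqxx all_cat.
  rewrite all_nseq nN orbT andbT; apply/allP => j /mapP [i _ ->].
  exact: ltn_trans (ltn_ord i) nN.
apply/setP => i; rewrite inE mem_cat mem_nseq (ltn_eqF (ltn_ord i)) andbF orbF.
by rewrite mem_map ?mem_enum //; exact: val_inj.
Qed.

(** * The two reductions as loop programs *)

Definition ESize : expr := ESum 6 (ECst 1).

Lemma stores_self (S : bvlist) :
  stores (size (enc_bvlist S)) (fun a => nth false (enc_bvlist S) a) (ECst 0) ESize S.
Proof.
split=> // [env|]; first by rewrite /ESize /= sum_nat_const_nat subn0 muln1.
by exists 0.
Qed.

Definition EInstLen : expr := EOnes (ECst 0).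
Definition EInst : expr := EAdd EInstLen (ECst 1).

Lemma den_inst_len (S : bvlist) (y : word) (env : nat -> nat) :
  let w := nseq (size (enc_bvlist S)) true ++ false :: enc_bvlist S ++ y in
  den (size w) (fun a => nth false w a) env EInstLen = size (enc_bvlist S).
Proof.
move=> w; apply: (@den_ones _ _ _ _ 0) => // [|i iS|].
- by rewrite /w size_cat size_nseq /= size_cat; lia.
- by rewrite /w nth_cat size_nseq iS nth_nseq iS.
- by rewrite /w nth_cat size_nseq ltnn subnn.
Qed.

Lemma stores_pair (S : bvlist) (y : word) :
  let w := nseq (size (enc_bvlist S)) true ++ false :: enc_bvlist S ++ y in
  stores (size w) (fun a => nth false w a) EInst EInstLen S.
Proof.
move=> w; split=> [env||]; first exact: den_inst_len.
  by rewrite /w size_cat /= size_cat; lia.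
exists (size (enc_bvlist S) + 1) => [env|a aS].
  by rewrite /EInst; cbn [den]; rewrite den_inst_len.
rewrite /w nth_cat size_nseq ltnNge -addnA leq_addr /= addKn add1n /= nth_cat aS.
by [].
Qed.

(* The bits of the second component of the pair. *)
Definition ESol (a : expr) : expr := EMem (EAdd (EAdd EInst EInstLen) a).

Lemma truth_sol (S : bvlist) (y : word) (env : nat -> nat) (a : expr) :
  let w := nseq (size (enc_bvlist S)) true ++ false :: enc_bvlist S ++ y in
  truth (size w) (fun a => nth false w a) env (ESol a) =
  nth false y (den (size w) (fun a => nth false w a) env a).
Proof.
move=> w; rewrite /truth /ESol /EInst; cbn [den]; rewrite den_inst_len.
rewrite {1}/w nth_cat size_nseq ltnNge -!addnA leq_addr /= addKn add1n /= nth_cat.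
by rewrite ltnNge leq_addr addKn eqb0 negbK.
Qed.

Lemma mkseq_const (T : Type) (f : nat -> T) (x : T) (n : nat) :
  (forall i, i < n -> f i = x) -> mkseq f n = nseq n x.
Proof.
move=> Hf; apply: (@eq_from_nth _ x) => [|i]; rewrite size_mkseq ?size_nseq // => iS.
by rewrite nth_mkseq // nth_nseq iS Hf.
Qed.

Lemma flatten_filter (T : eqType) (p : pred T) (h : T -> word) (ts : seq T) :
  flatten [seq if p t then map Some (h t) else [::] | t <- ts] =
  map Some (flatten [seq h t | t <- ts & p t]).
Proof. by elim: ts => //= t ts ->; case: (p t); rewrite //= map_cat. Qed.

(** Common shape of both reductions: one vector per accepted [k]-tuple, extended by [d] coordinates
    equal to [pad]. Different tuples may give the same vector, which the instances allow. *)
Definition CReduce (k d : nat) (pad : bool) (good : expr) (suffix : cmd) : cmd :=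
  CSeq (CBits (ECst 0) (ECst 1))
 (CSeq (CConst true d)
 (CSeq (CConst false 1)
 (CSeq (CLoops k (CIf good (CSeq (CConst true 1)
                           (CSeq (CBits (ECst 0) (EIn k 5)) (CConst pad d)))))
 (CSeq suffix
 (CSeq (CConst false 1) CEmit))))).

Lemma eval_reduce (k d : nat) (pad : bool) (good : expr) (suffix : cmd) (S : bvlist)
    (N := size (enc_bvlist S)) (M := fun a => nth false (enc_bvlist S) a : nat)
    (p : pred (seq nat)) (sw : word) (env : nat -> nat) :
  (forall env, truth N M env good = p [seq env (10 + l) | l <- iota 0 k]) ->
  (forall env, eval N M env suffix = map Some sw) ->
  eval N M env (CReduce k d pad good suffix) =
  events [:: nseq (tag S + d) true ++ false ::
    flatten [seq true :: mkseq (fun i => i \in t) (tag S) ++ nseq d pad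
            | t <- words N k & p t] ++ sw ++ [:: false]].
Proof.
move=> Hgood Hsuf; have HS := stores_self S.
rewrite /CReduce; cbn [eval].
rewrite !eval_const Hsuf (eval_bits (p := xpredT) HS) //.
rewrite (@eval_loops _ _ _ _ _ (fun t => if p t then
   map Some (true :: mkseq (fun i => i \in t) (tag S) ++ nseq d pad) else [::])); last first.
  move=> env' _; cbn [eval]; rewrite -Hgood /truth.
  case: eqP => // _; rewrite !eval_const.
  rewrite (eval_bits (p := fun i => i \in [seq env' (10 + l) | l <- iota 0 k]) HS) //.
    by rewrite /= map_cat.
  by move=> i iS; rewrite truth_in.
rewrite flatten_filter events1 nseqD (@mkseq_const _ xpredT true) //.
by rewrite !map_cat /= !map_cat -!catA /= -!catA.
Qed.

Definition EUncovered (k : nat) : expr :=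
  ENot (EHas (ECst 0) ESize
    (ENot (EEx (ECst 0) 4 (EIf (EIn k 4) (ENot (EBit (ECst 0) 3 4)))))).

Definition EIndep (k : nat) : expr :=
  ENot (EHas (ECst 0) ESize
    (ENot (EEx (ECst 0) 4 (EIf (EBit (ECst 0) 3 4) (ENot (EIn k 4)))))).

Lemma truth_uncovered (k : nat) (S : bvlist) (env : nat -> nat) :
  truth (size (enc_bvlist S)) (fun a => nth false (enc_bvlist S) a) env (EUncovered k) =
  ~~ covered (tagged S) (tset (tag S) [seq env (10 + l) | l <- iota 0 k]).
Proof.
have HS := stores_self S; set t := map _ _.
rewrite truth_not (truth_has (v0 := [tuple of nseq _ false])
  (p := fun s => tset (tag S) t \subset ones s) HS) // => r rS.
set v := nth _ _ _.
rewrite truth_not (truth_ex (p := fun i => (i \in t) && ~~ nth false v i) HS).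
  apply/existsPn/subsetP => H i; have := H i; rewrite !inE -tnth_nth.
    by rewrite negb_and negbK; case: (_ \in _).
  by case: (_ \in _) => //= ->.
move=> i iS; rewrite truth_and truth_not truth_in.
rewrite (truth_bit (i := Ordinal iS) [tuple of nseq _ false] HS) //.
by rewrite (tnth_nth false).
Qed.

Lemma truth_indep (k : nat) (H : hypergraph) (env : nat -> nat) :
  truth (size (enc_hypergraph H)) (fun a => nth false (enc_hypergraph H) a) env (EIndep k) =
  @independent H (tset (tag H) [seq env (10 + l) | l <- iota 0 k]).
Proof.
rewrite /enc_hypergraph; set S := existT _ _ _.
have HS := stores_self S; set t := map _ _.
rewrite truth_not (truth_has (v0 := [tuple of nseq _ false])
  (p := fun s => ones s \subset tset (tag S) t) HS) /=.
  rewrite has_map /independent all_predC; congr (~~ _).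
  by apply: eq_has => e /=; rewrite charvecK.
move=> r rS; set v := nth _ _ _.
rewrite truth_not (truth_ex (p := fun i => nth false v i && (i \notin t)) HS).
  apply/existsPn/subsetP => Hi i; have := Hi i; rewrite !inE -tnth_nth.
    by case: (tnth _ _) => //=; rewrite negbK.
  by case: (tnth _ _) => //= ->.
move=> i iS; rewrite truth_and truth_not truth_in.
rewrite (truth_bit (i := Ordinal iS) [tuple of nseq _ false] HS) //.
by rewrite (tnth_nth false).
Qed.

Lemma mkseqD (T : Type) (f : nat -> T) (m n : nat) :
  mkseq f (m + n) = mkseq f m ++ mkseq (fun i => f (m + i)) n.
Proof. by rewrite /mkseq iotaD map_cat addnC iotaDl -map_comp. Qed.

Lemma charvec_mkseq (m : nat) (p : pred nat) :
  charvec [set i : 'I_m | p i] = mkseq p m :> word.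
Proof.
apply: (@eq_from_nth _ false) => [|i]; rewrite size_tuple ?size_mkseq // => im.
by rewrite nth_mkseq // -(tnth_nth _ _ (Ordinal im)) tnth_mktuple inE.
Qed.

Lemma mkseq_charvec (n k : nat) (J : {set 'I_(n + k)}) :
  mkseq (nth false (charvec J)) n = charvec [set i | lshift k i \in J].
Proof.
apply: (@eq_from_nth _ false) => [|i]; rewrite size_mkseq ?size_tuple // => im.
rewrite nth_mkseq // -(tnth_nth _ _ (Ordinal im)) tnth_mktuple inE.
by rewrite -(tnth_nth _ _ (lshift k (Ordinal im))) tnth_mktuple.
Qed.

Definition lset (n k : nat) (J : {set 'I_(n + k)}) : {set 'I_n} :=
  [set i | lshift k i \in J].

(* Solutions of the closure problem become independent sets avoiding the sets
   that no vector of [S] covers; the additional edge consisting of [k] new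
   vertices forces the dimension to be [k]. *)
Definition closure_graph (k : nat) (S : bvlist) : hypergraph :=
  existT (fun n => seq {set 'I_n}) (tag S + k)
    (rcons [seq [set i : 'I_(tag S + k) | (i < tag S) && (val i \in t)]
           | t <- words (size (enc_bvlist S)) k
           & ~~ covered (tagged S) (tset (tag S) t)]
       [set i : 'I_(tag S + k) | tag S <= i]).

(* The additional coordinate, which is constantly 1, keeps the empty
   independent set apart from the excluded zero vector. *)
Definition graph_vectors (k : nat) (H : hypergraph) : bvlist :=
  existT (fun n => seq (n.-tuple bool)) (tag H + 1)
    [seq charvec [set i : 'I_(tag H + 1) | (val i == tag H) || (val i \in t)]
    | t <- words (size (enc_hypergraph H)) k & @independent H (tset (tag H) t)].

Definition CClosureGraph (k : nat) : cmd :=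
  CReduce k k false (EUncovered k)
    (CSeq (CConst true 1) (CSeq (CBits (ECst 0) (ECst 0)) (CConst true k))).

Definition CGraphVectors (k : nat) : cmd := CReduce k 1 true (EIndep k) CSkip.

Lemma eval_closure_graph (k : nat) (S : bvlist) :
  eval (size (enc_bvlist S)) (fun a => nth false (enc_bvlist S) a) (fun=> 0)
    (CClosureGraph k) = events [:: enc_hypergraph (closure_graph k S)].
Proof.
rewrite /CClosureGraph (@eval_reduce _ _ _ _ _ S
  (fun t => ~~ covered (tagged S) (tset (tag S) t))
  (true :: nseq (tag S) false ++ nseq k true)).
- congr (events [:: _]); rewrite /enc_hypergraph /enc_bvlist.
  cbn [tag tagged projT1 projT2 closure_graph].
  congr (_ ++ _ :: _); rewrite map_rcons map_rcons flatten_rcons -catA -map_comp -map_comp.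
  congr (_ ++ _).
    congr flatten; apply: eq_map => t.
    rewrite /= (charvec_mkseq _ (fun i => (i < tag S) && (i \in t))) mkseqD.
    congr (_ :: _ ++ _).
      by apply/eq_in_map => i; rewrite mem_iota => /= ->.
    by rewrite (@mkseq_const _ _ false) // => i _; rewrite ltnNge leq_addr.
  rewrite /= (charvec_mkseq _ (fun i => tag S <= i)) mkseqD; congr (_ :: _ ++ _).
  rewrite (@mkseq_const _ _ false) ?(@mkseq_const _ _ true) // => i iS.
    by rewrite leq_addr.
  by rewrite leqNgt iS.
- by move=> env; rewrite truth_uncovered.
- move=> env; cbn [eval]; rewrite !eval_const (eval_bits (p := xpred0) (stores_self S)) //.
  by rewrite (@mkseq_const _ _ false) // /= map_cat.
Qed.

Lemma eval_graph_vectors (k : nat) (H : hypergraph) :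
  eval (size (enc_hypergraph H)) (fun a => nth false (enc_hypergraph H) a) (fun=> 0)
    (CGraphVectors k) = events [:: enc_bvlist (graph_vectors k H)].
Proof.
rewrite /CGraphVectors /enc_hypergraph; set S := existT _ _ _.
rewrite (@eval_reduce _ _ _ _ _ S (fun t => @independent H (tset (tag H) t)) [::]) //.
  congr (events [:: _]); rewrite /enc_bvlist; cbn [tag tagged projT1 projT2 graph_vectors].
  congr (_ ++ _ :: _ ++ _); rewrite -map_comp.
  congr flatten; apply: eq_map => t.
  rewrite /= (charvec_mkseq _ (fun i => (i == tag H) || (i \in t))) mkseqD.
  congr (_ :: _ ++ _); last by rewrite /mkseq /= addn0 eqxx.
  by apply/eq_in_map => i; rewrite mem_iota => /= iS; rewrite (ltn_eqF iS).
by move=> env; rewrite truth_indep.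
Qed.

(** * Translating solutions back *)

Definition ESep (i j : nat) : expr :=
  EHas EInst EInstLen (EIf (ENot (EBit EInst 3 i)) (EBit EInst 3 j)).

Definition ESelected : expr :=
  EIf (EEx EInst 8 (ESep 7 8))
      (ENot (EEx EInst 8 (ENot (EAdd (ESep 7 8)
         (EIf (ENot (ELt (EVar 8) (EVar 7))) (ENot (ESep 8 7))))))).

Definition EAllOnes : expr := ENot (EEx EInst 4 (ENot (ESol (EVar 4)))).
Definition ESomeOne : expr := EEx EInst 4 (ESol (EVar 4)).

Definition CClosureSolutions : cmd :=
  CIf (ENot (ESol (EDim EInst)))
    (CSeq
      (CIf EAllOnes
        (CFor 7 (CIf (ELt (EVar 7) (EDim EInst))
          (CIf ESelected (CSeq (CBits EInst (ESep 7 5)) CEmit)))))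
      (CIf (ENot EAllOnes)
        (CIf ESomeOne (CSeq (CBits EInst (ESol (EVar 5))) CEmit)))).

(* Only the independent sets missing the first new vertex contribute. *)
Definition closure_solutions (S : bvlist) (y : word) : seq word :=
  if nth false y (tag S) then [::]
  else if [forall i : 'I_(tag S), nth false y i] then
    [seq tval (avoiding (tagged S) i) | i <- enum 'I_(tag S) & selected (tagged S) i]
  else if [exists i : 'I_(tag S), nth false y i] then [:: mkseq (nth false y) (tag S)]
  else [::].

Lemma truth_sep (N : nat) (M env : nat -> nat) (S : bvlist) (x y : nat) (i j : 'I_(tag S)) :
  stores N M EInst EInstLen S -> x != 3 -> y != 3 -> env x = i -> env y = j ->
  truth N M env (ESep x y) = separates (tagged S) i j.
Proof.
move=> HS x3 y3 xi yj.
apply: (truth_has (v0 := [tuple of nseq _ false]) HS) => r rS.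
rewrite truth_and truth_not.
rewrite (truth_bit (i := i) [tuple of nseq _ false] HS) ?eta_eq ?eta_neq //.
by rewrite (truth_bit (i := j) [tuple of nseq _ false] HS) ?eta_eq ?eta_neq.
Qed.

Lemma eval_if N M env e c :
  eval N M env (CIf e c) = if truth N M env e then eval N M env c else [::].
Proof. by rewrite /truth /=; case: eqP. Qed.

Lemma eval_seq N M env a b : eval N M env (CSeq a b) = eval N M env a ++ eval N M env b.
Proof. by []. Qed.

Lemma eval_for N M env x c :
  eval N M env (CFor x c) =
  flatten [seq eval N M [eta env with x |-> j] c | j <- iota 0 N].
Proof. by []. Qed.

Lemma truth_selected (N : nat) (M env : nat -> nat) (S : bvlist) (i : 'I_(tag S)) :
  stores N M EInst EInstLen S -> env 7 = i ->
  truth N M env ESelected = selected (tagged S) i.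
Proof.
move=> HS Ei.
have sep j (jS : j < tag S) : truth N M [eta env with 8 |-> j] (ESep 7 8) =
    separates (tagged S) i (Ordinal jS) by apply: truth_sep.
have sep' j (jS : j < tag S) : truth N M [eta env with 8 |-> j] (ESep 8 7) =
    separates (tagged S) (Ordinal jS) i by apply: truth_sep.
rewrite truth_and truth_not.
rewrite (truth_ex (p := fun j => truth N M [eta env with 8 |-> j] (ESep 7 8)) HS) //.
rewrite (truth_ex (p := fun j => ~~ (truth N M [eta env with 8 |-> j] (ESep 7 8) ||
   (i <= j) && ~~ truth N M [eta env with 8 |-> j] (ESep 8 7))) HS); last first.
  move=> j jS; rewrite truth_not truth_or truth_and !truth_not truth_lt -leqNgt.
  by have -> : den N M [eta env with 8 |-> j] (EVar 7) = i by [].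
have ordK (j : 'I_(tag S)) : Ordinal (ltn_ord j) = j by apply: val_inj.
congr (_ && _).
  by apply: eq_existsb => j; rewrite (sep j (ltn_ord j)) ordK.
rewrite negb_exists; apply: eq_forallb => j.
by rewrite (sep j (ltn_ord j)) (sep' j (ltn_ord j)) ordK negbK.
Qed.

Lemma eval_closure_solutions (S : bvlist) (y : word) :
  let w := nseq (size (enc_bvlist S)) true ++ false :: enc_bvlist S ++ y in
  eval (size w) (fun a => nth false w a) (fun=> 0) CClosureSolutions =
  events (closure_solutions S y).
Proof.
move=> w; set N := size w; set M := fun a => nth false w a : nat.
have HS : stores N M EInst EInstLen S := stores_pair S y.
have sol env a : truth N M env (ESol a) = nth false y (den N M env a) :=
  truth_sol S y env a.
have bits env : eval N M env (CSeq (CBits EInst (ESol (EVar 5))) CEmit) =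
    events [:: mkseq (nth false y) (tag S)].
  by rewrite events1 eval_seq (eval_bits (p := nth false y) HS).
have allones env : truth N M env EAllOnes = [forall i : 'I_(tag S), nth false y i].
  rewrite truth_not (truth_ex (p := fun i => ~~ nth false y i) HS); last first.
    by move=> i iS; rewrite truth_not sol.
  by rewrite negb_exists; apply: eq_forallb => i; rewrite negbK.
rewrite /CClosureSolutions /closure_solutions eval_if truth_not sol (den_dim _ HS).
case: (nth _ _ _) => //.
rewrite eval_seq !eval_if truth_not allones.
case: [forall _, _]; last first.
  rewrite (truth_ex (p := nth false y) HS); last by move=> i iS; rewrite sol.
  by case: [exists _, _]; rewrite // bits.
rewrite cats0 eval_for.
(* Loop indices are plain numbers; the default values are never reached below [tag S]. *)
pose sel j := if insub j is Some i then selected (tagged S) i else false.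
pose out j : word := if insub j is Some i then avoiding (tagged S) i else [::].
transitivity (flatten [seq (if j < tag S then if sel j then
    rcons (map Some (out j)) None else [::] else [::]) | j <- iota 0 N]).
  congr flatten; apply: eq_map => j.
  rewrite !eval_if truth_lt (den_dim _ HS).
  have -> : den N M [eta (fun=> 0) with 7 |-> j] (EVar 7) = j by [].
  case: ltnP => // jS; rewrite (truth_selected (i := Ordinal jS) HS) // /sel /out insubT.
  case: selected => //; rewrite eval_seq.
  rewrite (eval_bits (p := fun i => if insub i is Some i'
    then separates (tagged S) (Ordinal jS) i' else false) HS); last first.
    by move=> i iS; rewrite insubT; apply: truth_sep.
  rewrite -cats1; congr (map Some _ ++ _).
  apply: (@eq_from_nth _ false) => [|i]; rewrite size_mkseq ?size_tuple // => iS.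
  by rewrite nth_mkseq // insubT -(tnth_nth _ _ (Ordinal iS)) tnth_mktuple.
rewrite (flatten_iota_lt _ (ltnW (dim_le HS))) -val_enum_ord -map_comp /events -map_comp.
elim: (enum _) => //= i l ->; rewrite /sel /out valK.
by case: selected.
Qed.

Lemma closure_solutions_uniq (S : bvlist) (y : word) : uniq (closure_solutions S y).
Proof.
rewrite /closure_solutions; case: ifP => // _; case: ifP => _; last by case: ifP.
rewrite map_inj_in_uniq => [|i j]; first exact/filter_uniq/enum_uniq.
rewrite !mem_filter => /andP[Hi _] /andP[Hj _] /val_inj E.
exact: selected_inj Hi Hj E.
Qed.

Definition CGraphSolution : cmd := CSeq (CBits EInst (ESol (EVar 5))) CEmit.

Lemma eval_graph_solution (S : bvlist) (y : word) :
  let w := nseq (size (enc_bvlist S)) true ++ false :: enc_bvlist S ++ y in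
  eval (size w) (fun a => nth false w a) (fun=> 0) CGraphSolution =
  events [:: mkseq (nth false y) (tag S)].
Proof.
move=> w; rewrite events1 eval_seq (eval_bits (p := nth false y) (stores_pair S y)) //.
by move=> i iS; rewrite truth_sol.
Qed.

(** * Correctness of the reductions *)

Lemma lset_setU1l (n k : nat) (i : 'I_n) (J : {set 'I_(n + k)}) :
  lset (lshift k i |: J) = i |: lset J.
Proof. by apply/setP => j; rewrite !inE (inj_eq (@lshift_inj _ _)). Qed.

Lemma lset_setU1r (n k : nat) (e : 'I_k) (J : {set 'I_(n + k)}) :
  lset (rshift n e |: J) = lset J.
Proof. by apply/setP => j; rewrite !inE eq_lrshift. Qed.

Lemma independent_sub (H : hypergraph) (A B : {set 'I_(tag H)}) :
  A \subset B -> independent B -> independent A.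
Proof.
move=> AB; apply: sub_all => e; apply: contra => eA; exact: subset_trans AB.
Qed.

Lemma closure_graph_independent (k : nat) (S : bvlist) (J : {set 'I_(tag S + k)}) :
  @independent (closure_graph k S) J =
  kcovered k (tagged S) (lset J) && ~~ [forall e, rshift (tag S) e \in J].
Proof.
have lt_dim : tag S < size (enc_bvlist S) by rewrite size_enc_bvlist; nia.
rewrite /independent /= all_rcons andbC; congr (_ && _); last first.
  congr (~~ _); apply/subsetP/forallP => [H e|H i].
    by apply: H; rewrite inE leq_addr.
  by rewrite inE; case: (split_ordP i) => j -> //=; rewrite leqNgt ltn_ord.
have subE t : ([set i : 'I_(tag S + k) | (i < tag S) && (val i \in t)] \subset J) =
    (tset (tag S) t \subset lset J).
  apply/subsetP/subsetP => H i; rewrite !inE.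
    by move=> it; apply: H; rewrite inE /= ltn_ord.
  case: (split_ordP i) => j -> //= jt.
  by have := H j; rewrite !inE; apply.
rewrite all_map all_filter; apply/allP/kcoveredP => H.
  move=> T TJ Tk; have [t tw tT] := tset_words lt_dim Tk.
  by have := H t tw; rewrite /= subE tT TJ implybF negbK => /hasP.
move=> t; rewrite mem_words => /andP[/eqP tk _] /=; rewrite subE.
apply/implyP; apply: contra => tJ; apply/hasP; apply: H => //.
by rewrite -tk card_tset.
Qed.

(** The added edge attains [k]; all others come from words of length [k]. *)
Lemma closure_graph_dimension (k : nat) (S : bvlist) :
  dimension (closure_graph k S) == k.
Proof.
have cardD : #|[set i : 'I_(tag S + k) | tag S <= i]| = k.
  have -> : [set i : 'I_(tag S + k) | tag S <= i] = [set rshift (tag S) e | e in 'I_k].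
    apply/setP => i; rewrite inE; case: (split_ordP i) => j -> /=.
      rewrite leqNgt ltn_ord; symmetry; apply/negbTE/imsetP => -[e _ /eqP].
      by rewrite eq_lrshift.
    by rewrite leq_addr imset_f.
  by rewrite card_imset ?card_ord //; exact: rshift_inj.
rewrite eqn_leq /dimension /= -cats1 big_cat big_seq1 cardD leq_maxr andbT.
rewrite geq_max leqnn andbT; apply/bigmax_leqP_seq => e /mapP [t].
rewrite mem_filter mem_words => /and3P[_ /eqP tk _] -> _.
rewrite -[X in _ <= X]tk; apply: leq_trans (card_tset (tag S + k) t).
by apply/subset_leq_card/subsetP => i; rewrite !inE => /andP[].
Qed.

(** With one new vertex missing, the added edge cannot be contained in [J], so maximality puts in
    all other new vertices and leaves the old part to [kcovered] alone. *)
Lemma closure_graph_max (k : nat) (k0 : 0 < k) (S : bvlist) (J : {set 'I_(tag S + k)}) :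
  rshift (tag S) (Ordinal k0) \notin J ->
  maxset (@independent (closure_graph k S)) J <->
  maxset (kcovered k (tagged S)) (lset J) /\
  (forall e : 'I_k, (rshift (tag S) e \in J) = (e != Ordinal k0)).
Proof.
move=> nJ.
have notall (K : {set 'I_(tag S + k)}) : rshift (tag S) (Ordinal k0) \notin K ->
    ~~ [forall e, rshift (tag S) e \in K].
  by move=> nK; apply/forallPn; exists (Ordinal k0).
rewrite (maxset_hereditaryP _ (@independent_sub (closure_graph k S))).
rewrite (maxset_hereditaryP _ (@kcovered_sub k (tag S) (tagged S))).
rewrite closure_graph_independent (notall J nJ) andbT.
split=> [[cJ H]|[[cJ H] He]].
  split.
    split=> // i; rewrite inE => iJ.
    have := H _ iJ; rewrite closure_graph_independent lset_setU1l notall ?andbT //.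
    by rewrite in_setU1 eq_sym eq_lrshift.
  move=> e; have [->|e0] := eqVneq e (Ordinal k0); first exact: negbTE.
  apply: contraT => eJ; have := H _ eJ.
  rewrite closure_graph_independent lset_setU1r cJ notall //.
  by rewrite in_setU1 (inj_eq (@rshift_inj _ _)) eq_sym (negbTE e0).
split=> // i iJ; rewrite closure_graph_independent.
case: (split_ordP i) iJ => j -> iJ.
  rewrite lset_setU1l negb_and H //; by rewrite inE.
rewrite negb_and negbK; apply/orP; right; apply/forallP => e.
rewrite in_setU1 (inj_eq (@rshift_inj _ _)) He.
by move: iJ; rewrite He negbK => /eqP ->; case: eqP.
Qed.

(* The independent set of [closure_graph] that represents [I]. *)
Definition pad_set (n k : nat) (I : {set 'I_n}) : {set 'I_(n + k)} :=
  [set i : 'I_(n + k) | if split i is inl a then a \in I else val i != n].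

Lemma lset_pad_set (n k : nat) (I : {set 'I_n}) : lset (pad_set k I) = I.
Proof. by apply/setP => i; rewrite !inE (unsplitK (inl _ i)). Qed.

Lemma rshift_pad_set (n k : nat) (I : {set 'I_n}) (e : 'I_k) :
  (rshift n e \in pad_set k I) = (val e != 0).
Proof.
by rewrite inE (unsplitK (inr _ e)) /= -[X in _ != X]addn0 eqn_add2l.
Qed.

Lemma pad_set_max (k : nat) (k0 : 0 < k) (S : bvlist) (I : {set 'I_(tag S)}) :
  maxset (kcovered k (tagged S)) I ->
  maxset (@independent (closure_graph k S)) (pad_set k I).
Proof.
move=> Imax; apply/(closure_graph_max (k0 := k0)).
  by rewrite rshift_pad_set.
by rewrite lset_pad_set; split=> // e; rewrite rshift_pad_set.
Qed.

Lemma nth_charvec (m : nat) (J : {set 'I_m}) (i : 'I_m) : nth false (charvec J) i = (i \in J).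
Proof. by rewrite -tnth_nth tnth_mktuple. Qed.

Lemma closure_solutions_charvec (k : nat) (k0 : 0 < k) (S : bvlist)
    (J : {set 'I_(tag S + k)}) :
  closure_solutions S (charvec J) =
  if rshift (tag S) (Ordinal k0) \in J then [::]
  else if lset J == setT then
    [seq tval (avoiding (tagged S) i) | i <- enum 'I_(tag S) & selected (tagged S) i]
  else if lset J == set0 then [::] else [:: tval (charvec (lset J))].
Proof.
rewrite /closure_solutions.
have -> : nth false (charvec J) (tag S) = (rshift (tag S) (Ordinal k0) \in J).
  by rewrite -nth_charvec /= addn0.
case: (_ \in J) => //.
have E (i : 'I_(tag S)) : nth false (charvec J) i = (i \in lset J).
  by rewrite inE -nth_charvec.
have -> : [forall i : 'I_(tag S), nth false (charvec J) i] = (lset J == setT).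
  apply/forallP/eqP => [H|JT i]; last by rewrite E JT inE.
  by apply/setP => i; rewrite -E H inE.
case: eqP => // _.
have -> : [exists i : 'I_(tag S), nth false (charvec J) i] = (lset J != set0).
  by apply/existsP/set0Pn => -[i]; rewrite ?E => Ji; exists i; rewrite ?E.
by case: eqP => // _; rewrite mkseq_charvec.
Qed.

Lemma kcovered_setT (k : nat) (S : bvlist) (I : {set 'I_(tag S)}) :
  kcovered k (tagged S) setT -> maxset (kcovered k (tagged S)) I <-> I = setT.
Proof.
move=> cT; split=> [/maxsetP [_ H]|->]; first by rewrite (H _ cT (subsetT _)).
by apply/maxsetP; split=> // B _; rewrite subTset => /eqP.
Qed.

Lemma closure_reduction (k : nat) : 2 < k ->
  polydelay_reduction (EnumClosureMax (S10 k)) (EnumKMaxIndSet k).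
Proof.
move=> k2; have k0 : 0 < k by lia.
pose f (S : bvlist) : khypergraph k :=
  exist _ (closure_graph k S) (closure_graph_dimension k S).
exists f, (fun xy s => s \in closure_solutions xy.1 xy.2); split.
- apply: (@polytime_of_cmd _ _ _ (CClosureGraph k)) => S.
  exact: etrans (congr1 outputs (eval_closure_graph k S)) (outputs_events _).
- apply: (@polydelay_of_cmd _ CClosureSolutions) => -[S y] o.
  have -> : o = closure_solutions S y.
    exact: etrans (congr1 outputs (eval_closure_solutions S y)) (outputs_events _).
  by split; first exact: closure_solutions_uniq.
(* Sets with nonempty translations miss the same new vertex, hence have the same new part and are
   determined by their old parts. In the covered case both old parts are full; otherwise the
   translation prints the old part. *)
- move=> S y z [J Jmax ->] [K Kmax ->] neq s [] /=.
  rewrite !(closure_solutions_charvec k0).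
  case: (boolP (rshift _ _ \in J)) => // nJ; case: (boolP (rshift _ _ \in K)) => // nK.
  have [JI JE] := (closure_graph_max nJ).1 Jmax.
  have [KI KE] := (closure_graph_max nK).1 Kmax.
  have JK : lset J = lset K -> False.
    move=> E; apply: neq; congr (tval (charvec _)); apply/setP => i.
    case: (split_ordP i) => j ->; last by rewrite JE KE.
    by have /setP/(_ j) := E; rewrite !inE.
  have [cT|ncT] := boolP (kcovered k (tagged S) setT).
    by case: JK; move: JI KI => /(kcovered_setT _ cT) -> /(kcovered_setT _ cT).
  have nT (L : {set 'I_(tag S + k)}) :
      maxset (kcovered k (tagged S)) (lset L) -> (lset L == setT) = false.
    by move=> Lmax; apply/negbTE; apply: contraNneq ncT => <-; apply: maxsetp Lmax.
  rewrite !nT //; case: ifP => // _; case: ifP => // _; rewrite !inE => /eqP -> /eqP E.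
  by apply: JK; apply: charvec_inj; apply: val_inj.
- move=> S s.
  have [cT|ncT] := boolP (kcovered k (tagged S) setT).
    split.
      move=> [v /(ClMax_covered _ k2 cT) [i si ->] ->].
      exists (charvec (pad_set k [set: 'I_(tag S)])).
        exists (pad_set k setT) => //; apply: (pad_set_max k0).
        exact/(kcovered_setT _ cT).
      rewrite /= (closure_solutions_charvec k0) rshift_pad_set lset_pad_set !eqxx /=.
      by apply/mapP; exists i => //; rewrite mem_filter si mem_enum.
    move=> [_ [J Jmax ->]] /=; rewrite (closure_solutions_charvec k0).
    case: ifP => // nJ; have [JI _] := (closure_graph_max (negbT nJ)).1 Jmax.
    move/(kcovered_setT _ cT): JI => ->; rewrite eqxx => /mapP [i].
    rewrite mem_filter => /andP[si _] ->; exists (avoiding (tagged S) i) => //.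
    by apply/(ClMax_covered _ k2 cT); exists i.
  split.
    move=> [v /(ClMax_uncovered _ k2 ncT) [vmax v0] ->].
    exists (charvec (pad_set k (ones v))).
      by exists (pad_set k (ones v)) => //; apply: (pad_set_max k0).
    rewrite (closure_solutions_charvec k0) rshift_pad_set lset_pad_set onesK (negbTE v0).
    rewrite ifN; first exact: mem_head.
    by apply: contraNneq ncT => <-; apply: maxsetp vmax.
  move=> [_ [J Jmax ->]] /=; rewrite (closure_solutions_charvec k0).
  case: ifP => // nJ; have [JI _] := (closure_graph_max (negbT nJ)).1 Jmax.
  rewrite ifN; last by apply: contraNneq ncT => <-; apply: maxsetp JI.
  case: eqP => // /eqP J0; rewrite inE => /eqP ->.
  exists (charvec (lset J)) => //; apply/(ClMax_uncovered _ k2 ncT).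
  by rewrite charvecK.
Qed.

(** An edge has at most [k] vertices, so it is among the tested sets, and a vector covering it would
    come from a dependent set. Conversely, an independent set of at most [k] vertices gives a vector
    of its own. The added coordinate lies in all vectors and constrains nothing. *)
Lemma graph_vectors_kcovered (k : nat) (H : hypergraph) (J : {set 'I_(tag H + 1)}) :
  dimension H <= k ->
  kcovered k (tagged (graph_vectors k H)) J = @independent H (lset J).
Proof.
move=> Hk.
have lt_dim : tag H < size (enc_hypergraph H) by rewrite size_enc_bvlist /=; nia.
apply/kcoveredP/allP => [HJ e eH|HJ T TJ Tk].
  apply/negP => eJ.
  have ek : #|e| <= k.
    by apply: leq_trans Hk; rewrite /dimension (big_rem e eH) leq_maxl.
  have [||v] := HJ [set lshift 1 i | i in e].
  - by apply/subsetP => _ /imsetP [i ie ->]; have := subsetP eJ i ie; rewrite inE.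
  - by rewrite card_imset //; exact: lshift_inj.
  case/mapP => t; rewrite mem_filter => /andP[/allP/(_ e eH) et _] ->.
  rewrite charvecK => /subsetP sub; case/negP: et; apply/subsetP => i ie.
  have := sub _ (imset_f (lshift 1) ie); rewrite !inE /= => /orP[/eqP Ei|//].
  by have := ltn_ord i; rewrite Ei ltnn.
have Tk' : #|lset T| <= k.
  apply: leq_trans Tk; rewrite -(card_imset _ (@lshift_inj _ 1)).
  by apply/subset_leq_card/subsetP => _ /imsetP [i + ->]; rewrite inE.
have [t tw tT] := tset_words lt_dim Tk'.
exists (charvec [set i : 'I_(tag H + 1) | (val i == tag H) || (val i \in t)]).
  apply/mapP; exists t => //; rewrite mem_filter tw andbT tT.
  apply/allP => e eH; apply: contra (HJ e eH) => /subset_trans; apply.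
  by apply/subsetP => i; rewrite !inE => /(subsetP TJ).
rewrite charvecK; apply/subsetP => i; rewrite inE.
case: (split_ordP i) => j -> /= jT.
  have : j \in lset T by rewrite inE.
  by rewrite -tT inE /= => ->; rewrite orbT.
by rewrite ord1 addn0 eqxx.
Qed.

Lemma graph_vectors_max (k : nat) (H : hypergraph) (J : {set 'I_(tag H + 1)}) :
  dimension H <= k ->
  maxset (kcovered k (tagged (graph_vectors k H))) J <->
  rshift (tag H) ord0 \in J /\ maxset (@independent H) (lset J).
Proof.
move=> Hk.
rewrite (maxset_hereditaryP _ (@kcovered_sub k _ _)).
rewrite (maxset_hereditaryP _ (@independent_sub H)).
rewrite graph_vectors_kcovered //; split=> [[iJ max]|[J0 [iJ max]]].
  split.
    apply: contraT => /max.
    by rewrite graph_vectors_kcovered // lset_setU1r iJ.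
  split=> // i; rewrite inE => /max.
  by rewrite graph_vectors_kcovered // lset_setU1l.
split=> // i; rewrite graph_vectors_kcovered //.
case: (split_ordP i) => j -> jJ; last by rewrite ord1 J0 in jJ.
by rewrite lset_setU1l max // inE.
Qed.

Lemma graph_reduction (k : nat) : 2 < k ->
  polydelay_reduction (EnumKMaxIndSet k) (EnumClosureMax (S10 k)).
Proof.
move=> k2; pose f (H : khypergraph k) : bvlist := graph_vectors k (val H).
have ClM (H : khypergraph k) (v : (tag (val H) + 1).-tuple bool) :
    ClMax (S10 k) (tagged (f H)) v <->
    rshift (tag (val H)) ord0 \in ones v /\ maxset (@independent (val H)) (lset (ones v)).
  case: H v => H /eqP Hk /= v; have leHk : dimension H <= k by rewrite Hk.
  rewrite -(graph_vectors_max _ leHk) ClMax_uncovered //.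
    split=> [[]//|vmax]; split=> //; apply/set0Pn.
    by exists (rshift (tag H) ord0); have /(graph_vectors_max _ leHk) [] := vmax.
  (* The dimension is positive, so there is a hyperedge and the full set is not independent: the
     uncovered case always applies. *)
  rewrite graph_vectors_kcovered //; apply/allPn.
  have : tagged H != [::].
    by apply/eqP => H0; move: Hk; rewrite /dimension H0 big_nil; lia.
  case: (tagged H) => // e E _; exists e; rewrite ?mem_head // negbK.
  by apply/subsetP => i _; rewrite !inE.
exists f, (fun xy s => s = mkseq (nth false xy.2) (tag (val xy.1))); split.
- apply: (@polytime_of_cmd _ _ _ (CGraphVectors k)) => H.
  exact: etrans (congr1 outputs (eval_graph_vectors k (val H))) (outputs_events _).
- apply: (@polydelay_of_cmd _ CGraphSolution) => -[H y] o.
  have -> : o = [:: mkseq (nth false y) (tag (val H))].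
    exact: etrans (congr1 outputs (eval_graph_solution _ y)) (outputs_events _).
  by split=> // s; rewrite inE; split=> [/eqP|->].
(* Every solution contains the added coordinate, so dropping it is injective. *)
- move=> H _ _ [v /ClM [v0 _] ->] [w /ClM [w0 _] ->] neq s [-> /=].
  rewrite -[v]onesK -[w]onesK !mkseq_charvec => /val_inj /charvec_inj E.
  apply: neq; congr tval; apply: (can_inj (@onesK _)); apply/setP => i.
  case: (split_ordP i) => j ->; last by rewrite ord1 v0 w0.
  by have /setP/(_ j) := E; rewrite !inE.
- move=> H s; split.
    move=> [I Imax ->].
    pose J := rshift (tag (val H)) (@ord0 0) |: [set lshift 1 i | i in I].
    have JI : lset J = I.
      apply/setP => i; rewrite !inE eq_lrshift /= mem_imset //; exact: lshift_inj.
    exists (charvec J); last by rewrite /= mkseq_charvec -/(lset J) JI.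
    by exists (charvec J) => //; apply/ClM; rewrite charvecK JI setU11.
  move=> [_ [v /ClM [_ vmax] ->] ->] /=; exists (lset (ones v)) => //.
  by rewrite -{1}[v]onesK mkseq_charvec.
Qed.

Theorem theorem45 (k : nat) (hk : 3 < k) :
  polydelay_equivalent (EnumClosureMax (S10 k)) (EnumKMaxIndSet k).
Proof.
by split; [apply: closure_reduction | apply: graph_reduction]; apply: ltnW.
Qed.
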